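(* Let $M$ be a compact Riemannian manifold and let $X$ be a Lipschitz vector field on $M$. If $p\in M$ is quasi-regular, then the limit $J_p:=\lim_{T\to\infty}J_T$ exists in $\hat{\mathcal{B}}_1^1(M)$, where $J_T=\frac1T(\phi_p)_*\widetilde{[0,T]}\in\hat{\mathcal{B}}_1^1(M)$.
   Context: Chains on $M$. $\mathcal{P}_1(M)$ is the real vector space of finitely supported sections of $TM$, written as formal sums $\sum_i(p_i;\alpha_i)$ with $\alpha_i\in T_{p_i}M$. For $u\in T_pM$ put $\Delta_u(p;\alpha)=(\exp_pu;\alpha_u)-(p;\alpha)$, where $\alpha_u$ is the parallel transport (Levi-Civita connection) of $\alpha$ along the geodesic $t\mapsto\exp_p(tu)$, $0\le t\le1$. Set $|(p;\alpha)|_0=\|\alpha\|$ and $|\Delta_u(p;\alpha)|_1=\|u\|\,\|\alpha\|$. The norm $\|A\|_{B^1}$ on $\mathcal{P}_1(M)$ is the infimum of $\sum_i|\alpha_i'|$, where the infimum is over all ways of writing $A$ as a finite sum of terms each of the form $(p;\alpha)$ or $\Delta_u(p;\alpha)$ and $|\alpha_i'|$ denotes the corresponding value $|(p;\alpha)|_0$ or $|\Delta_u(p;\alpha)|_1$ of the $i$-th term. $\hat{\mathcal{B}}_1^1(M)$ is the completion of $\mathcal{P}_1(M)$ in this norm. Its dual $\mathcal{B}_1^1(M)$ is the space of $1$-forms $\omega$ with $\|\omega\|_{B^1}=\sup\{|\omega(p;\alpha)|:\|\alpha\|=1\}\vee\sup\{|\omega(\Delta_u(p;\alpha))|:\|u\|\|\alpha\|=1\}<\infty$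 (bounded Lipschitz $1$-forms), with $\omega(\sum(p_i;\alpha_i))=\sum\omega_{p_i}(\alpha_i)$, extended by continuity; one writes $\int_J\omega:=\omega(J)$. The chain $J_T$. $\phi_p(t)$ is the flow of $X$ at time $t$ starting at $p$. $\widetilde{[0,T]}$ is the $1$-chain of order $1$ in $\mathbb{R}$ canonically associated with $[0,T]$, i.e. $\int_{\widetilde{[0,T]}}\eta=\int_0^T\eta$ for all bounded Lipschitz $1$-forms $\eta$ on $\mathbb{R}$, and $(\phi_p)_*$ is the continuous extension to chains of $(t;\lambda)\mapsto(\phi_p(t);\lambda X(\phi_p(t)))$. Thus $\int_{J_T}\omega=\frac1T\int_0^T\omega_{\phi_p(t)}(X(\phi_p(t)))\,dt$ for $\omega\in\mathcal{B}_1^1(M)$. Quasi-regular. $p\in M$ is quasi-regular if $\lim_{T\to\infty}\frac1T\int_0^Tf(\phi_p(t))\,dt$ exists for every continuous $f:M\to\mathbb{R}$. *)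

(* Defs.v *)
From HB Require Import structures.
From mathcomp Require Import all_boot all_order all_algebra.
From mathcomp Require Import all_classical all_reals all_analysis.

Set Implicit Arguments.
Unset Strict Implicit.
Unset Printing Implicit Defensive.

Import Order.TTheory GRing.Theory Num.Theory.
Import numFieldNormedType.Exports.

Local Open Scope classical_set_scope.
Local Open Scope ring_scope.

Section Smooth.
Context {R : realType} {V W : normedModType R}.

Fixpoint Ck_on (k : nat) (U : set V) (f : V -> W) : Prop :=
  match k with
  | 0 => forall x, U x -> {for x, continuous f}
  | k'.+1 => (forall x, U x -> differentiable f x) /\
             (forall v, Ck_on k' U ('D_v f))
  end.

Definition smooth_on (U : set V) (f : V -> W) : Prop :=
  forall k, Ck_on k U f.

End Smooth.

(* A tangent vector at [p] is represented throughout by the row vector of its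
   coordinates in the preferred chart [chart_at p]; a section of TM is thus a
   function [point -> 'rV_n]. *)
Record smoothManifold (R : realType) (n : nat) := SmoothManifold {
  point :> topologicalType ;
  chart_index : Type ;
  dom : chart_index -> set point ;
  chart : chart_index -> point -> 'rV[R]_n ;
  chart_inv : chart_index -> 'rV[R]_n -> point ;
  chart_at : point -> chart_index ;
  point_hausdorff : hausdorff_space point ;
  point_second_countable : @second_countable point ;
  dom_open : forall i, open (dom i) ;
  dom_chart_at : forall p, dom (chart_at p) p ;
  chartK : forall i p, dom i p -> chart_inv i (chart i p) = p ;
  chart_image_open : forall i, open (chart i @` dom i) ;
  chart_continuous : forall i p, dom i p -> {for p, continuous (chart i)} ;
  chart_inv_continuous : forall i x, (chart i @` dom i) x ->
    {for x, continuous (chart_inv i)} ;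
  transition_smooth : forall i j,
    smooth_on (chart i @` (dom i `&` dom j)) (chart j \o chart_inv i)
}.

Section Tangent.
Context {R : realType} {n : nat} (M : smoothManifold R n).

(* Coordinates in chart [i] of [al] in T_pM, for [p] in [dom i]. *)
Definition tcoord (i : chart_index M) (p : M) (al : 'rV[R]_n) : 'rV[R]_n :=
  'D_al (chart i \o chart_inv (chart_at p)) (chart (chart_at p) p).

(* The element of T_pM whose coordinates in chart [i] are [a]. *)
Definition tvector (i : chart_index M) (p : M) (a : 'rV[R]_n) : 'rV[R]_n :=
  'D_a (chart (chart_at p) \o chart_inv i) (chart i p).

(* The derivative of [gam] at [t] exists and equals [v] in T_(gam t)M. Whether
   this holds does not depend on the chart [i] around [gam t]. *)
Definition velocity (gam : R -> M) (t : R) (v : 'rV[R]_n) : Prop :=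
  exists i, [/\ dom i (gam t), {for t, continuous gam} &
    is_derive t (1 : R) (chart i \o gam) (tcoord i (gam t) v)].

End Tangent.

(* [metric_mx p] is the Gram matrix of the inner product on T_pM. *)
Definition local_metric {R : realType} {n : nat} (M : smoothManifold R n)
    (metric_mx : M -> 'M[R]_n) (i : chart_index M) (x : 'rV[R]_n) : 'M[R]_n :=
  let p := chart_inv i x in
  \matrix_(a, b)
    (tvector i p (delta_mx 0 a) *m metric_mx p
       *m (tvector i p (delta_mx 0 b))^T) 0 0.

Record riemannianManifold (R : realType) (n : nat) := RiemannianManifold {
  manifold :> smoothManifold R n ;
  metric_mx : manifold -> 'M[R]_n ;
  metric_sym : forall p, (metric_mx p)^T = metric_mx p ;
  metric_pos : forall p (u : 'rV[R]_n), u != 0 ->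
    0 < (u *m metric_mx p *m u^T) 0 0 ;
  metric_smooth : forall i,
    smooth_on (chart i @` dom i) (local_metric metric_mx i)
}.

Section Riemannian.
Context {R : realType} {n : nat} (M : riemannianManifold R n).

Definition tnorm (p : M) (u : 'rV[R]_n) : R :=
  Num.sqrt ((u *m metric_mx p *m u^T) 0 0).

(* Christoffel symbol Gamma^k_(ab) of the Levi-Civita connection in chart [i],
   as a function on the image of the chart. *)
Definition christoffel (i : chart_index M) (x : 'rV[R]_n) (k a b : 'I_n) : R :=
  let g := local_metric (@metric_mx R n M) i in
  let d (c : 'I_n) : 'M[R]_n := 'D_(delta_mx 0 c) g x in
  2^-1 * \sum_(l < n) invmx (g x) k l * (d a b l + d b a l - d l a b).

(* The section [W] of TM along [gam] has covariant derivative 0 at time [t]: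
   (W^k)' + Gamma^k_(ab) (gam^a)' W^b = 0. By tensoriality this does not depend
   on the chart [i] around [gam t]. *)
Definition parallel_at (gam : R -> M) (W : R -> 'rV[R]_n) (t : R) : Prop :=
  exists i (a : 'rV[R]_n),
    [/\ dom i (gam t), {for t, continuous gam},
        is_derive t (1 : R) (chart i \o gam) a &
        is_derive t (1 : R) (fun s => tcoord i (gam s) (W s))
          (- \row_k \sum_(b < n) \sum_(c < n)
               christoffel i (chart i (gam t)) k b c * a 0 b
                 * tcoord i (gam t) (W t) 0 c)].

Definition geodesic_on (I : interval R) (gam : R -> M) (V : R -> 'rV[R]_n)
    : Prop :=
  forall t, t \in I -> velocity gam t (V t) /\ parallel_at gam V t.

(* [q] = exp_p u and [be] = al_u: there is a geodesic from [p] to [q] with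
   initial velocity [u] along which [al] is transported to [be]. Geodesics live
   on a neighbourhood of [0, 1] so that all derivatives are two-sided. *)
Definition exp_transport (p : M) (u al : 'rV[R]_n) (q : M) (be : 'rV[R]_n)
    : Prop :=
  exists (e : R) (gam : R -> M) (V W : R -> 'rV[R]_n),
    [/\ 0 < e, geodesic_on `]- e, 1 + e[ gam V,
        forall t, t \in `]- e, 1 + e[ -> parallel_at gam W t,
        gam 0 = p /\ gam 1 = q &
        [/\ V 0 = u, W 0 = al & W 1 = be]].

(* Lipschitz with respect to parallel transport along geodesics, as for the
   bounded Lipschitz 1-forms below. *)
Definition lipschitz_field (X : M -> 'rV[R]_n) : Prop :=
  exists K : R, forall p u q be, exp_transport p u (X p) q be ->
    tnorm q (X q - be) <= K * tnorm p u.

Definition flow_of (X : M -> 'rV[R]_n) (phi : M -> R -> M) : Prop :=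
  forall p, phi p 0 = p /\ forall t, velocity (phi p) t (X (phi p t)).

Definition quasi_regular (phi : M -> R -> M) (p : M) : Prop :=
  forall f : M -> R, continuous f ->
    cvg ((T^-1 * \int[lebesgue_measure]_(t in `[0, T]) f (phi p t))
           @[T --> +oo]).

Definition finite_support : {pred M -> 'rV[R]_n} :=
  fun A => `[< finite_set [set p | A p != 0] >].

Lemma finite_support_closed : submod_closed finite_support.
Proof.
split.
  apply/asboolP; rewrite (_ : [set _ | _] = set0) //.
  by apply/seteqP; split => p //= /eqP.
move=> a A B /asboolP fA /asboolP fB; apply/asboolP.
apply: (sub_finite_set _ (_ : finite_set
    ([set p | A p != 0] `|` [set p | B p != 0]))); last by rewrite finite_setU.
move=> p /= h; have [A0|nA] := eqVneq (A p) 0; last by left.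
right; apply: contra_neq h => B0.
by rewrite !fctE A0 B0 scaler0 addr0.
Qed.

HB.instance Definition _ :=
  GRing.isSubmodClosed.Build R (M -> 'rV[R]_n) finite_support
    finite_support_closed.

(* P_1(M): the finitely supported sections of TM. *)
Record chain := Chain {
  chain_fun :> M -> 'rV[R]_n ;
  chain_finite : chain_fun \in finite_support }.

HB.instance Definition _ := [isSub for chain_fun].
HB.instance Definition _ := [Choice of chain by <:].
HB.instance Definition _ := [SubChoice_isSubLmodule of chain by <:].

Lemma elem_subproof (p : M) (al : 'rV[R]_n) :
  (fun q : M => if q == p then al else 0) \in finite_support.
Proof.
apply/asboolP; apply: (sub_finite_set _ (finite_set1 p)) => q /=.
by case: (eqVneq q p) => // _; move=> /eqP.
Qed.

(* (p; al) *)
Definition elem (p : M) (al : 'rV[R]_n) : chain := Chain (elem_subproof p al).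

(* The pairs (term, value of the term): ((p; al), |(p; al)|_0) and
   (Delta_u (p; al), |Delta_u (p; al)|_1). *)
Definition weighted_term : set (chain * R) :=
  [set x | (exists p al, x = (elem p al, tnorm p al)) \/
           (exists p u al q be, exp_transport p u al q be /\
              x = (elem q be - elem p al, tnorm p u * tnorm p al))].

Definition B1norm (A : chain) : R :=
  inf [set r | exists s : seq (chain * R),
         [/\ forall x, x \in s -> weighted_term x,
             A = \sum_(x <- s) x.1 &
             r = \sum_(x <- s) x.2]].

(* A completion of (P_1(M), B1norm); it is unique up to isometry. *)
Record B1completion := B1Completion {
  B1space :> completeNormedModType R ;
  B1incl : {linear chain -> B1space} ;
  B1incl_norm : forall A, `|B1incl A| = B1norm A ;
  B1incl_dense : dense (range B1incl)
}.

(* A 1-form is given by the columns [om p] of coordinates of elements of the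
   dual of T_pM, in the coordinates of [chart_at p]. *)

Definition form_at (om : M -> 'cV[R]_n) (p : M) (al : 'rV[R]_n) : R :=
  (al *m om p) 0 0.

Definition form_chain (om : M -> 'cV[R]_n) (A : chain) : R :=
  \sum_(p \in [set: M]) form_at om p (A p).

Definition form_B1norm (om : M -> 'cV[R]_n) : \bar R :=
  maxe
    (ereal_sup [set x | exists p al, tnorm p al = 1 /\
       x = (`|form_chain om (elem p al)|)%:E])
    (ereal_sup [set x | exists p u al q be,
       [/\ exp_transport p u al q be, tnorm p u * tnorm p al = 1 &
           x = (`|form_chain om (elem q be - elem p al)|)%:E]]).

Definition bounded_lipschitz (om : M -> 'cV[R]_n) : Prop :=
  (form_B1norm om < +oo)%E.

(* [ell] is the extension by continuity of [om] to the completion [B], so that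
   [ell J] is the integral of [om] over the chain [J]. *)
Definition extends_form (B : B1completion) (om : M -> 'cV[R]_n)
    (ell : {linear B -> R^o}) : Prop :=
  continuous ell /\ forall A, ell (B1incl B A) = form_chain om A.

End Riemannian.

Section RealLine.
Context (R : realType).

Lemma real_second_countable : @second_countable R.
Proof.
exists ((fun x : rat * rat => ball (ratr x.1 : R) (ratr x.2 : R)) @` setT).
  exact: (sub_countable (card_image_le _ _) (countableP _)).
split=> [_ [x _ <-]|x A]; first exact: ball_open.
rewrite nbhsE => -[B [oB Bx] BA].
have [c [r /= [/set_mem xcr crB]]] := open_subball_rat oB (mem_set Bx).
exists (ball (ratr c : R) (ratr r : R)); last exact: subset_trans BA.
by split => //; exists (c, r).
Qed.

Definition line_chart (t : R) : 'rV[R]_1 := const_mx t.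
Definition line_inv (x : 'rV[R]_1) : R := x 0 0.

Lemma line_chartK : cancel line_chart line_inv.
Proof. by move=> t; rewrite /line_inv mxE. Qed.

Lemma line_invK : line_chart \o line_inv = id.
Proof. by apply/funext => x; apply/rowP => j; rewrite mxE (ord1 j). Qed.

Lemma line_chart_image_open : open (line_chart @` [set: R]).
Proof.
rewrite (_ : _ @` _ = setT); first exact: openT.
apply/seteqP; split => // x _; exists (line_inv x) => //.
exact: (congr1 (@^~ x) line_invK).
Qed.

Lemma line_chart_continuous : continuous line_chart.
Proof.
move=> t A /nbhs_ballP[e e0 eA]; apply/nbhs_ballP; exists e => // s ts.
by apply: eA; split=> // i j; rewrite !mxE.
Qed.

Lemma Ck_on_cst (V W : normedModType R) (c : W) k (U : set V) :
  Ck_on k U (cst c : V -> W).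
Proof.
elim: k c => [|k IH] c /=; first by move=> x _; exact: cvg_cst.
split=> [x _|v]; first exact: differentiable_cst.
rewrite (_ : 'D_v _ = cst 0); first exact: IH.
by apply/funext => x; rewrite derive_cst.
Qed.

Lemma smooth_on_id (V : normedModType R) (U : set V) :
  smooth_on U (id : V -> V).
Proof.
case=> [|k] /=; first by move=> x _; exact: cvg_id.
split=> [x _|v].
  exact: ex_diff.
rewrite (_ : 'D_v _ = cst v); first exact: Ck_on_cst.
by apply/funext => x; rewrite derive_id.
Qed.

Lemma line_transition_smooth (U : set 'rV[R]_1) :
  smooth_on U (line_chart \o line_inv).
Proof. by rewrite line_invK; exact: smooth_on_id. Qed.

Definition line_manifold : smoothManifold R 1 :=
  @SmoothManifold R 1 R unit (fun=> setT) (fun=> line_chart)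
    (fun=> line_inv) (fun=> tt)
    (@norm_hausdorff R R) real_second_countable (fun=> openT) (fun=> I)
    (fun _ t _ => line_chartK t) (fun=> line_chart_image_open)
    (fun _ t _ => @line_chart_continuous t)
    (fun _ x _ => @coord_continuous R 1 1 0 0 x)
    (fun _ _ => @line_transition_smooth _).

Lemma line_metric_sym (p : line_manifold) : (1%:M)^T = 1%:M :> 'M[R]_1.
Proof. exact: trmx1. Qed.

Lemma line_metric_pos (p : line_manifold) (u : 'rV[R]_1) : u != 0 ->
  0 < (u *m 1%:M *m u^T) 0 0.
Proof.
move=> u0; rewrite mulmx1 mxE big_ord1 mxE -expr2 lt_neqAle sqr_ge0.
rewrite eq_sym sqrf_eq0 andbT; apply: contra_neq u0 => u0.
by apply/rowP => j; rewrite (ord1 j) u0 mxE.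
Qed.

Lemma line_metric_smooth (i : chart_index line_manifold) :
  smooth_on (@chart _ _ line_manifold i @` dom i)
    (local_metric (fun _ : line_manifold => 1%:M) i).
Proof.
move=> k; rewrite (_ : local_metric _ _ = cst 1%:M); first exact: Ck_on_cst.
apply/funext => x; apply/matrixP => a b; rewrite /local_metric /tvector mxE /=.
rewrite line_invK !derive_id (ord1 a) (ord1 b).
by rewrite mulmx1 mxE big_ord1 !mxE !eqxx mulr1.
Qed.

(* R with its Euclidean metric. *)
Definition real_line : riemannianManifold R 1 :=
  RiemannianManifold line_metric_sym line_metric_pos line_metric_smooth.

End RealLine.

Section PushedInterval.
Context {R : realType} {n : nat} {M : riemannianManifold R n}.
Context {BR : B1completion (real_line R)} {BM : B1completion M}.

(* [J] is the 1-chain of R canonically associated with [0, T]; the integral of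
   a 1-form over [0, T] is that of its values on the unit vector field. *)
Definition is_interval_chain (T : R) (J : BR) : Prop :=
  forall (eta : real_line R -> 'cV[R]_1) (ell : {linear BR -> R^o}),
    bounded_lipschitz eta -> extends_form eta ell ->
    ell J = \int[lebesgue_measure]_(t in `[0, T]) form_at eta t (const_mx 1).

(* [F] is the continuous extension to chains of
   (t; lam) |-> (phi_p(t); lam X(phi_p(t))). *)
Definition is_pushforward (X : M -> 'rV[R]_n) (phi : M -> R -> M) (p : M)
    (F : {linear BR -> BM}) : Prop :=
  continuous F /\
  forall (t : real_line R) (lam : 'rV[R]_1),
    F (B1incl BR (elem t lam)) =
      B1incl BM (elem (phi p t) (lam 0 0 *: X (phi p t))).

End PushedInterval.

(* Main.v *)
(* Let C(q) be the class of (q; X q) in the completion. The map C is continuous: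
   a point q near p is joined to p by a short geodesic with initial velocity u,
   and C(q) - C(p) is the class of (q; X q - be) + Delta_u (p; X p), with be the
   transport of X p, so its norm is at most (K + |X p|) |u|. In a chart, a
   geodesic with prescribed end points and the parallel fields along it are
   fixed points of contractions, since the Christoffel symbols are locally
   Lipschitz and enter multiplied by the small velocity.

   By Hahn-Banach, J_T is determined by the identities
   ell(J_T) = 1/T int_0^T ell(C(phi_p(t))) dt. As M is compact, C is uniformly
   close to a finite sum of f_i C(p_i) with (f_i) a partition of unity; hence J_T
   is uniformly close to the sum of a_i(T) C(p_i), where a_i(T) is the average of
   f_i over [0, T] along the orbit, which converges as p is quasi-regular. So J_T
   is Cauchy as T tends to +oo. *)

Require Import Defs.
From HB Require Import structures.
From mathcomp Require Import all_boot all_order all_algebra.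
From mathcomp Require Import all_classical all_reals all_analysis.
From mathcomp Require Import finmap ring lra.

Set Implicit Arguments.
Unset Strict Implicit.
Unset Printing Implicit Defensive.

Import Order.TTheory GRing.Theory Num.Theory.
Import numFieldNormedType.Exports.

Local Open Scope classical_set_scope.
Local Open Scope ring_scope.

(** * Primitives and contractions of curves *)

Section VectorCalculus.
Context {R : realType}.

Lemma row_norm_le n (a : 'rV[R]_n) (c : R) :
  0 <= c -> (forall j, `|a 0 j| <= c) -> `|a| <= c.
Proof.
move=> c0 h; rewrite [leLHS]/Num.Def.normr/= mx_normrE.
by apply: bigmax_le => // -[i j] _ /=; rewrite (ord1 i).
Qed.

Lemma mx_entry_le m n (A : 'M[R]_(m, n)) i j : `|A i j| <= `|A|.
Proof.
rewrite [leRHS]/Num.Def.normr/= mx_normrE.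
exact: (le_bigmax _ (fun ij : 'I_m * 'I_n => `|A ij.1 ij.2|) (i, j)).
Qed.

Lemma is_derive_row (V : normedModType R) n (f : V -> 'rV[R]_n) x v
    (df : 'rV[R]_n) :
  (forall j, is_derive x v (fun y => f y 0 j) (df 0 j)) -> is_derive x v f df.
Proof.
move=> h; have fx : derivable f x v.
  by apply/derivable_mxP => i j; rewrite (ord1 i); have [] := h j.
apply: DeriveDef => //; rewrite derive_mx//.
by apply/rowP => j; rewrite mxE; have [] := h j.
Qed.

Lemma is_derive_continuous (V : normedModType R) (f : R -> V) x df :
  is_derive x (1 : R) f df -> {for x, continuous f}.
Proof.
move=> [fx _]; apply: differentiable_continuous; exact/derivable1_diffP.
Qed.

Lemma is_derive_lipschitz (f df : R -> R) (a b c : R) : a <= b ->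
  (forall x, a <= x <= b -> is_derive x (1 : R) f (df x)) ->
  (forall x, a <= x <= b -> `|df x| <= c) ->
  `|f b - f a| <= c * (b - a).
Proof.
move=> ab fdf dfc.
have [x||x xab ->] := @MVT_segment R f df a b ab.
- by rewrite in_itv /= => /andP[ax xb]; apply: fdf; rewrite !ltW.
- by apply: derivable_within_continuous => x /fdf[].
- rewrite normrM (@ger0_norm _ (b - a)) ?subr_ge0// ler_wpM2r ?subr_ge0//.
  exact: dfc.
Qed.

End VectorCalculus.

Section Primitive.
Context {R : realType}.
Local Notation mu := lebesgue_measure.

(* The base point [-2] lies strictly below the interval [-1, 2] on which curves
   are considered, so that [prim f] has a two-sided derivative there. *)
Definition prim (f : R -> R) (t : R) : R :=
  \int[mu]_(s in `[-2, t]) f s - \int[mu]_(s in `[-2, 0]) f s.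

Lemma continuous_integrable_itv (f : R -> R) (a b : R) : continuous f ->
  mu.-integrable `[a, b] (EFin \o f).
Proof.
move=> cf; apply: continuous_compact_integrable; first exact: segment_compact.
exact: continuous_subspaceT.
Qed.

Lemma prim0 f : prim f 0 = 0. Proof. by rewrite /prim subrr. Qed.

Lemma primB (f g : R -> R) (t : R) : continuous f -> continuous g ->
  prim (fun s => f s - g s) t = prim f t - prim g t.
Proof.
move=> cf cg; rewrite /prim !RintegralB//;
  by [lra|exact: measurable_itv|exact: continuous_integrable_itv].
Qed.

Lemma prim_cst (c t : R) : -2 < t -> prim (fun=> c) t = c * t.
Proof.
move=> t2; rewrite /prim !Rintegral_cst//= !lebesgue_measure_itv/= !lte_fin t2.
rewrite (_ : (-2 < 0 :> R)) ?ltrN10 /=; lra.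
Qed.

Lemma is_derive_prim (f : R -> R) (t : R) : continuous f -> -2 < t ->
  is_derive t (1 : R) (prim f) (f t).
Proof.
move=> cf t2; have tt1 : t < t + 1 by rewrite ltrDl.
have [df f't] := @continuous_FTC1_closed R f (-2) t (t + 1) tt1
  (@continuous_integrable_itv _ _ _ cf) t2 (cf t).
have d : is_derive t 1 (fun s => \int[mu]_(x in `[-2, s]) f x) (f t).
  by apply: (DeriveDef df); rewrite -derive1E.
rewrite -[f t]subr0; exact: is_deriveB.
Qed.

Lemma prim_lipschitz (f : R -> R) (c s t : R) : continuous f ->
  (forall x, `|f x| <= c) -> -2 < s -> -2 < t ->
  `|prim f s - prim f t| <= c * `|s - t|.
Proof.
move=> cf fc.
wlog ts : s t / t <= s => [wlg s2 t2|s2 t2].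
  have [ts|/ltW st] := leP t s; first exact: wlg.
  by rewrite distrC (distrC s); exact: wlg.
rewrite (@ger0_norm _ (s - t)) ?subr_ge0//.
apply: (@is_derive_lipschitz _ (prim f) f) => // x /andP[tx _].
by apply: is_derive_prim => //; exact: lt_le_trans tx.
Qed.

Context {n : nat}.
Implicit Types f g : R -> 'rV[R]_n.

Definition vprim f (t : R) : 'rV[R]_n := \row_j prim (fun s => f s 0 j) t.

Lemma continuous_entry f j : continuous f -> continuous (fun s => f s 0 j).
Proof.
move=> cf t; apply: (@continuous_comp _ _ _ f (fun a : 'rV_n => a 0 j)).
  exact: cf.
exact: coord_continuous.
Qed.

Lemma vprim0 f : vprim f 0 = 0.
Proof. by apply/rowP => j; rewrite !mxE prim0. Qed.

Lemma vprimB f g (t : R) : continuous f -> continuous g ->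
  vprim (fun s => f s - g s) t = vprim f t - vprim g t.
Proof.
move=> cf cg; apply/rowP => j; rewrite !mxE -primB; first last.
- exact: continuous_entry.
- exact: continuous_entry.
- by congr prim; apply/funext => s; rewrite !mxE.
Qed.

Lemma vprim_cst (c : 'rV[R]_n) (t : R) : -2 < t ->
  vprim (fun=> c) t = t *: c.
Proof. by move=> t2; apply/rowP => j; rewrite !mxE prim_cst// mulrC. Qed.

Lemma is_derive_vprim f (t : R) : continuous f -> -2 < t ->
  is_derive t (1 : R) (vprim f) (f t).
Proof.
move=> cf t2; apply: is_derive_row => j.
rewrite (_ : (fun y => _) = prim (fun s => f s 0 j)).
  by apply: is_derive_prim => //; exact: continuous_entry.
by apply/funext => s; rewrite mxE.
Qed.

Lemma vprim_lipschitz f (c s t : R) : continuous f ->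
  (forall x, `|f x| <= c) -> -2 < s -> -2 < t ->
  `|vprim f s - vprim f t| <= c * `|s - t|.
Proof.
move=> cf fc s2 t2; apply: row_norm_le => [|j].
  by rewrite mulr_ge0// (le_trans _ (fc 0)).
rewrite !mxE; apply: prim_lipschitz => // [|x]; first exact: continuous_entry.
exact: le_trans (mx_entry_le _ _ _) (fc x).
Qed.

End Primitive.

(* Joins the existing complete and normed structures on matrices. *)
HB.instance Definition _ (R : realType) (m n : nat) :=
  Uniform_isComplete.Build 'M[R]_(m, n) (@cauchy_cvg 'M[R^o]_(m, n)).

Section FunctionContraction.
Context {R : realType} {V : completeNormedModType R}.
Implicit Types (f g : R -> V).

(* Closed under pointwise limits, so that Picard iterates can be passed to the
   limit pointwise. *)
Definition bounded_lip (B : R) f : Prop :=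
  (forall t, `|f t| <= B) /\ (forall s t, `|f s - f t| <= B * `|s - t|).

Lemma bounded_lip_continuous B f : bounded_lip B f -> continuous f.
Proof.
move=> [fB fl] t; apply/cvgrPdist_lt => e e0.
have B0 : 0 <= B by exact: le_trans (fB 0).
have B1 : 0 < B + 1 by rewrite ltr_wpDl.
near=> s; apply: le_lt_trans (fl _ _) _.
apply: (@le_lt_trans _ _ ((B + 1) * `|t - s|)).
  by rewrite ler_wpM2r// lerDl.
rewrite -ltr_pdivlMl//; near: s.
by apply: (@cvgr_dist_lt _ R^o); rewrite // mulr_gt0// invr_gt0.
Unshelve. all: by end_near. Qed.

(** The iterates [u k] of the zero curve stay in the class, and consecutive halvings put [u (j + k)]
    within 2B / 2^k of [u k]. They are therefore Cauchy at each time; the pointwise limit keeps the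
    bounds, and comparing it with [u k.+1] shows that [Phi] fixes it. Only completeness of [V]
    enters, not of a space of curves. *)
Lemma contraction_bounded_lip (B : R) (Phi : (R -> V) -> R -> V) :
  0 <= B ->
  (forall f, bounded_lip B f -> bounded_lip B (Phi f)) ->
  (forall f g d, bounded_lip B f -> bounded_lip B g ->
     (forall t, `|f t - g t| <= d) ->
     forall t, `|Phi f t - Phi g t| <= d / 2) ->
  exists2 f, bounded_lip B f & forall t, Phi f t = f t.
Proof.
move=> B0 PhiB Phi_contr.
pose u k : R -> V := iter k Phi (fun=> 0).
have uB k : bounded_lip B (u k).
  elim: k => [|k IH]; last exact: PhiB.
  by split=> [t|s t]; rewrite ?subrr normr0// mulr_ge0.
have u_dist k j t : `|u (j + k)%N t - u k t| <= geometric (2 * B) 2^-1 k.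
  elim: k t => [|k IH] t.
    rewrite /geometric /= expr0 mulr1 addn0 subr0.
    by apply: le_trans (proj1 (uB j) t) _; lra.
  have := Phi_contr _ _ _ (uB (j + k)%N) (uB k) IH t.
  by rewrite /geometric /= addnS exprSr mulrA.
have geo0 : geometric (2 * B) (2^-1 : R) @ \oo --> (0 : R).
  by apply: cvg_geometric; rewrite gtr0_norm ?invf_lt1 ?invr_gt0//; lra.
have u_cvg t : cvg (u ^~ t @ \oo).
  apply: cauchy_cvg; apply: cauchy_exP => e e0.
  have [N _ Ne] : \forall k \near \oo, `|geometric (2 * B) 2^-1 k : R| < e.
    by have /cvgr0_norm_lt := geo0; apply.
  exists (u N t); exists N => // m /= Nm; rewrite -ball_normE /= distrC.
  rewrite -(subnK Nm); apply: le_lt_trans (u_dist _ _ _) _.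
  exact: le_lt_trans (ler_norm _) (Ne N (leqnn N)).
pose f t := lim (u ^~ t @ \oo).
have uf t : u ^~ t @ \oo --> f t by exact: u_cvg.
have f_dist k t : `|f t - u k t| <= geometric (2 * B) 2^-1 k.
  have h : `|u m t - u k t| @[m --> \oo] --> `|f t - u k t|.
    by apply: cvg_norm; apply: cvgB => //; exact: cvg_cst.
  apply: (cvgr_to_le h); exists k => // m /= km.
  by rewrite -(subnK km).
have fB : bounded_lip B f.
  split=> [t|s t].
    by apply: (cvgr_to_le (cvg_norm (uf t))); exists 0 => // m _; case: (uB m).
  apply: (cvgr_to_le (cvg_norm (cvgB (uf s) (uf t)))); exists 0 => // m _.
  by have [_] := uB m; apply.
exists f => // t; apply/eqP; rewrite -subr_eq0 -normr_le0.
have le_geo k : `|Phi f t - f t| <= geometric (2 * B) 2^-1 k.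
  rewrite -(subrKA (u k.+1 t)) (le_trans (ler_normD _ _))//.
  have := Phi_contr _ _ _ fB (uB k) (f_dist k) t; rewrite -/(u k.+1) => h1.
  have := f_dist k.+1 t; rewrite distrC {2}/geometric /= exprSr mulrA => h2.
  apply: le_trans (lerD h1 h2) _; rewrite /geometric /=; lra.
by apply: (cvgr_to_ge geo0); exists 0 => // k _; exact: le_geo.
Qed.

End FunctionContraction.

(** * Geodesics and parallel fields in coordinates *)

Section ClampedPrimitive.
Context {R : realType}.

(* Clamping time to [-1, 2] makes the curves globally bounded and Lipschitz. *)
Definition clamp (t : R) : R := Num.max (-1) (Num.min 2 t).

Lemma clamp_ge t : -1 <= clamp t.
Proof. by rewrite /clamp le_max lexx. Qed.

Lemma clamp_le t : clamp t <= 2.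
Proof. by rewrite /clamp ge_max ge_min lexx /= andbT; lra. Qed.

Lemma clamp_id t : -1 <= t -> t <= 2 -> clamp t = t.
Proof. by move=> h1 h2; rewrite /clamp (min_idPr h2) (max_idPr h1). Qed.

Lemma clamp_lip s t : `|clamp s - clamp t| <= `|s - t|.
Proof.
wlog ts : s t / t <= s => [wlg|].
  have [ts|/ltW st] := leP t s; first exact: wlg.
  by rewrite distrC (distrC s); exact: wlg.
rewrite (@ger0_norm _ (s - t)) ?subr_ge0//.
rewrite /clamp.
have m2 : (-1 <= 2 :> R) by lra.
case: (leP 2 t) => t2; case: (leP 2 s) => s2; rewrite ?(max_idPr m2) ler_norml;
  by [case: (leP (-1) s) => h1; case: (leP (-1) t) => h2; apply/andP; split;
    lra].
Qed.

Context {n : nat}.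
Implicit Types f g : R -> 'rV[R]_n.

Definition cprim f (t : R) : 'rV[R]_n := vprim f (clamp t).

Lemma cprim_lipschitz f (c s t : R) : continuous f ->
  (forall x, `|f x| <= c) -> `|cprim f s - cprim f t| <= c * `|s - t|.
Proof.
move=> cf fc; have c0 : 0 <= c by exact: le_trans (fc 0).
have clamp2 u : -2 < clamp u by rewrite (lt_le_trans _ (clamp_ge u))//; lra.
apply: le_trans (vprim_lipschitz cf fc _ _) _ => //.
by rewrite ler_wpM2l// clamp_lip.
Qed.

(** The factor 2 is the greatest distance from 0 to a clamped time. *)
Lemma cprim_le f (c t : R) : continuous f ->
  (forall x, `|f x| <= c) -> `|cprim f t| <= 2 * c.
Proof.
move=> cf fc; have c0 : 0 <= c by exact: le_trans (fc 0).
rewrite -[cprim f t]subr0 -(vprim0 f).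
apply: le_trans (vprim_lipschitz cf fc _ _) _.
- by rewrite (lt_le_trans _ (clamp_ge t))//; lra.
- lra.
- rewrite subr0 mulrC ler_wpM2r// ler_norml clamp_le andbT.
  by rewrite (le_trans _ (clamp_ge t))//; lra.
Qed.

Lemma cprim_continuous f (c : R) : continuous f ->
  (forall x, `|f x| <= c) -> continuous (cprim f).
Proof.
move=> cf fc; have c0 : 0 <= c by exact: le_trans (fc 0).
apply: (@bounded_lip_continuous R 'rV[R]_n (2 * c)); split=> [t|s t].
  exact: cprim_le.
apply: le_trans (cprim_lipschitz _ _ cf fc) _.
by rewrite ler_wpM2r//; lra.
Qed.

Lemma cprimB f g t : continuous f -> continuous g ->
  cprim (fun s => f s - g s) t = cprim f t - cprim g t.
Proof. exact: vprimB. Qed.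

Lemma is_derive_cprim f (t : R) : continuous f -> -1 < t < 2 ->
  is_derive t (1 : R) (cprim f) (f t).
Proof.
move=> cf /andP[t1 t2]; apply: (@near_eq_is_derive _ _ _ (vprim f)).
  have : \forall s \near t, s \in `]-1, 2[.
    by apply: near_in_itvoo; rewrite in_itv /= t1.
  apply: filterS => s; rewrite in_itv /= => /andP[s1 s2].
  by rewrite /cprim clamp_id// ltW.
by apply: is_derive_vprim => //; lra.
Qed.

End ClampedPrimitive.

Section GeodesicEquation.
Context {R : realType} {n : nat}.
Local Notation V := 'rV[R]_n.
Context (Q : V -> V -> V -> V) (x : V) (r C rho : R).
Context (QBl : forall z a a' b, Q z (a - a') b = Q z a b - Q z a' b).
Context (QBr : forall z a b b', Q z a (b - b') = Q z a b - Q z a b').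
Context (C0 : 0 <= C).
Context (Q_le : forall z a b, `|z - x| < r -> `|Q z a b| <= C * `|a| * `|b|).
Context (Q_lip : forall z z' a b, `|z - x| < r -> `|z' - x| < r ->
  `|Q z a b - Q z' a b| <= C * `|z - z'| * `|a| * `|b|).
Context (rho0 : 0 < rho).
Context (rho1 : rho <= 1).
Context (rhor : 2 * rho < r).
Context (Crho : C * rho <= 32^-1).

(** The arguments are changed one at a time, first the base point and then the two vectors: the
    first change costs the Lipschitz bound, the others the size bound on [Q]. *)
Let Q_dist z z' a a' b b' (A B d e f : R) :
  `|z - x| < r -> `|z' - x| < r -> `|a| <= A -> `|a'| <= A -> `|b| <= B ->
  `|b'| <= B -> `|z - z'| <= d -> `|a - a'| <= e -> `|b - b'| <= f ->
  `|Q z a b - Q z' a' b'| <= C * (d * A * B + e * B + A * f).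
Proof.
move=> zx z'x aA a'A bB b'B zd ae bf.
have -> : Q z a b - Q z' a' b' =
    (Q z a b - Q z' a b) + Q z' (a - a') b + Q z' a' (b - b').
  by rewrite QBl QBr -!addrA !addKr.
apply: le_trans (ler_normD _ _) _; rewrite mulrDr lerD//; last first.
  by apply: le_trans (Q_le _ _ z'x) _; rewrite -mulrA ler_wpM2l// ler_pM.
apply: le_trans (ler_normD _ _) _; rewrite mulrDr lerD//; last first.
  by apply: le_trans (Q_le _ _ z'x) _; rewrite -mulrA ler_wpM2l// ler_pM.
apply: le_trans (Q_lip _ _ zx z'x) _.
rewrite -!mulrA ler_wpM2l// !mulrA; by apply: ler_pM => //; exact: ler_pM.
Qed.

(** The curve from [x] with velocity [v]. With speed at most [rho] it moves by at most
    [2 * rho < r], so it never leaves the ball where the bounds on [Q] hold. *)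
Let pos (v : R -> V) (t : R) : V := x + cprim v t.

Let pos_near v t : bounded_lip rho v -> `|pos v t - x| < r.
Proof.
move=> vB; rewrite /pos addrAC subrr add0r; apply: le_lt_trans rhor.
by apply: cprim_le; [exact: bounded_lip_continuous vB|case: vB].
Qed.

Let acc (v w : R -> V) (t : R) : V := Q (pos v t) (v t) (w t).

Let acc_le v w B t : bounded_lip rho v -> bounded_lip B w ->
  `|acc v w t| <= B / 32.
Proof.
move=> vB wB; apply: le_trans (Q_le _ _ (pos_near t vB)) _.
rewrite mulrC ler_pM ?mulr_ge0//; first by case: wB.
by apply: le_trans Crho; rewrite ler_wpM2l//; case: vB.
Qed.

Let acc_continuous v w B : bounded_lip rho v -> bounded_lip B w ->
  continuous (acc v w).
Proof.
move=> vB wB; have [vr vl] := vB; have [wr wl] := wB.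
have B0 : 0 <= B by exact: le_trans (wr 0).
have vc := bounded_lip_continuous vB.
(* The first summand bounds the size of [acc v w], the second its Lipschitz constant as given by
   [Q_dist]; the sum serves for both. *)
pose K := B / 32 + C * (rho * rho * B + rho * B + rho * B).
have rp := ltW rho0.
apply: (@bounded_lip_continuous _ _ K); split=> [t|s t].
  apply: le_trans (acc_le t vB wB) _; rewrite /K lerDl.
  by rewrite mulr_ge0// !addr_ge0// !mulr_ge0.
apply: le_trans (Q_dist (pos_near s vB) (pos_near t vB) (vr s) (vr t) (wr s)
  (wr t) _ (vl s t) (wl s t)) _.
  rewrite /pos opprD addrACA subrr add0r.
  exact: cprim_lipschitz.
rewrite /K mulrDl -[leLHS]add0r lerD ?mulr_ge0//.
by rewrite -!mulrA ler_wpM2l//; lra.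
Qed.

(* The geodesic from [x] to [y] solves a fixed point equation for its velocity,
   with the constant of integration chosen so that the end point is [y]: no
   local inversion of the exponential map is needed. *)
Lemma geodesic_velocity y : `|y - x| <= rho / 2 ->
  exists2 v, bounded_lip rho v &
    x + vprim v 1 = y /\
    forall t : R, -1 < t < 2 -> is_derive t (1 : R) v (- acc v v t).
Proof.
move=> yx.
pose c (v : R -> V) : V := y - x + vprim (cprim (acc v v)) 1.
pose Phi (v : R -> V) (t : R) : V := c v - cprim (acc v v) t.
have r0 := ltW rho0.
have m12 : -2 < 1 :> R by lra.
have m02 : -2 < 0 :> R by lra.
have cpc (v : R -> V) : bounded_lip rho v -> continuous (cprim (acc v v)).
  move=> vB; apply: (@cprim_continuous _ _ _ (rho / 32)) => [|t].
    exact: (acc_continuous vB vB).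
  exact: acc_le.
have vprim1 (f : R -> V) (e : R) : continuous f -> (forall t, `|f t| <= e) ->
    `|vprim f 1| <= e.
  move=> cf fe; have := vprim_lipschitz cf fe m12 m02.
  by rewrite vprim0 !subr0 normr1 mulr1.
have [|v vB|v v' d vB v'B vv' t|v vB vE] :=
    @contraction_bounded_lip R V rho Phi.
- exact: r0.
- have ac := acc_continuous vB vB.
  have ale t := acc_le t vB vB.
  split=> [t|s t].
    (* The three contributions are at most rho / 2, rho / 16 and rho / 16, so their sum stays below
       [rho]. *)
    rewrite /Phi /c; apply: le_trans (ler_normB _ _) _.
    have h1 : `|cprim (acc v v) t| <= 2 * (rho / 32) by exact: cprim_le.
    have h2 : `|vprim (cprim (acc v v)) 1| <= 2 * (rho / 32).
      by apply: vprim1 => [|s]; [exact: cpc|exact: cprim_le].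
    have := ler_normD (y - x) (vprim (cprim (acc v v)) 1); rewrite /c; lra.
  rewrite /Phi opprB addrC addrA subrK.
  apply: le_trans (cprim_lipschitz _ _ ac ale) _.
  by rewrite distrC ler_wpM2r//; lra.
- have [vr _] := vB; have [v'r _] := v'B.
  have vc := bounded_lip_continuous vB; have v'c := bounded_lip_continuous v'B.
  have ac := acc_continuous vB vB; have a'c := acc_continuous v'B v'B.
  have d0 : 0 <= d by exact: le_trans (vv' 0).
  (* Velocities at distance [d] give positions at distance at most [2 * d], and [C * rho <= 32^-1]
     turns the estimate into d / 8. Each of the two primitives in [Phi] doubles this at most, which
     leaves the required d / 2. *)
  have aa s : `|acc v v s - acc v' v' s| <= d / 8.
    apply: le_trans (Q_dist (pos_near s vB) (pos_near s v'B) (vr s) (v'r s)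
      (vr s) (v'r s) (_ : _ <= 2 * d) (vv' s) (vv' s)) _.
      rewrite /pos opprD addrACA subrr add0r -cprimB//; apply: cprim_le => //.
      by move=> u; apply: continuousB; [exact: vc|exact: v'c].
    have -> : C * (2 * d * rho * rho + d * rho + rho * d) =
      (C * rho) * (2 * d * rho + 2 * d) by ring.
    have h : 2 * d * rho + 2 * d <= 4 * d.
      by have := ler_wpM2l d0 rho1; lra.
    have h0 : 0 <= 2 * d * rho + 2 * d by rewrite addr_ge0// !mulr_ge0.
    by apply: le_trans (ler_pM _ h0 Crho h) _; [rewrite mulr_ge0|lra].
  have aac : continuous (fun s => acc v v s - acc v' v' s).
    by move=> u; apply: continuousB; [exact: ac|exact: a'c].
  have ci s : `|cprim (acc v v) s - cprim (acc v' v') s| <= 2 * (d / 8).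
    by rewrite -cprimB//; apply: cprim_le.
  have vi : `|vprim (cprim (acc v v)) 1 - vprim (cprim (acc v' v')) 1|
      <= 2 * (d / 8).
    rewrite -vprimB; [|exact: cpc|exact: cpc]; apply: vprim1 => [u|s].
      by apply: continuousB; apply: cpc.
    exact: ci.
  have -> : Phi v t - Phi v' t =
      (vprim (cprim (acc v v)) 1 - vprim (cprim (acc v' v')) 1)
      - (cprim (acc v v) t - cprim (acc v' v') t).
    have E (a p p' b b' : V) :
        (a + p) - b - (a + p' - b') = (p - p') - (b - b').
      by apply/rowP => j; rewrite !mxE; ring.
    exact: E.
  apply: le_trans (ler_normB _ _) _; have := ci t; lra.
- exists v => //; have vc := bounded_lip_continuous vB; split=> [|t t12].
    have {1}-> : v = fun t => c v - cprim (acc v v) t.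
      by apply/funext => t; rewrite -[LHS]vE.
    rewrite vprimB; [|by move=> ?; exact: cvg_cst|exact: cpc].
    by rewrite vprim_cst// scale1r /c addrK addrC subrK.
  have vE' : Phi v = v by apply/funext => s; exact: vE.
  rewrite -[X in is_derive _ _ X _]vE'.
  rewrite -sub0r; apply: is_deriveB.
  by apply: is_derive_cprim => //; exact: (acc_continuous vB vB).
Qed.

(** The transport equation is linear in [w], so smallness of [v] alone makes the integral operator a
    contraction, for [al] of any size. The bound B = 2 |al| is preserved because |al| + B / 16 <=
    B. *)
Lemma parallel_field v (al : V) : bounded_lip rho v ->
  exists2 w : R -> V, w 0 = al &
    forall t : R, -1 < t < 2 -> is_derive t (1 : R) w (- acc v w t).
Proof.
move=> vB; have [vr _] := vB; have vc := bounded_lip_continuous vB.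
pose B := 2 * `|al|.
pose Phi (w : R -> V) (t : R) : V := al - cprim (acc v w) t.
have B0 : 0 <= B by rewrite mulr_ge0.
have [w wB|w w' d wB w'B ww' t|w wB wE] :=
    @contraction_bounded_lip R V B Phi B0.
- have ac := acc_continuous vB wB.
  have ale t := acc_le t vB wB.
  split=> [t|s t].
    rewrite /Phi; apply: le_trans (ler_normB _ _) _.
    have h1 : `|cprim (acc v w) t| <= 2 * (B / 32) by exact: cprim_le.
    by move: B0; rewrite /B in h1 *; lra.
  rewrite /Phi opprB addrC addrA subrK.
  apply: le_trans (cprim_lipschitz _ _ ac ale) _.
  by rewrite distrC ler_wpM2r//; lra.
- have wc := bounded_lip_continuous wB; have w'c := bounded_lip_continuous w'B.
  have ac := acc_continuous vB wB; have a'c := acc_continuous vB w'B.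
  have d0 : 0 <= d by exact: le_trans (ww' 0).
  have aa s : `|acc v w s - acc v w' s| <= d / 32.
    rewrite /acc -QBr; apply: le_trans (Q_le _ _ (pos_near s vB)) _.
    rewrite mulrC ler_pM ?mulr_ge0//.
    by apply: le_trans Crho; rewrite ler_wpM2l.
  have aac : continuous (fun s => acc v w s - acc v w' s).
    by move=> u; apply: continuousB; [exact: ac|exact: a'c].
  have ci : `|cprim (acc v w) t - cprim (acc v w') t| <= 2 * (d / 32).
    by rewrite -cprimB//; apply: cprim_le.
  by rewrite /Phi opprB addrC addrA subrK distrC; lra.
- exists w => [|t t12].
    rewrite -[LHS]wE /Phi /cprim clamp_id ?vprim0 ?subr0//; lra.
  have wE' : Phi w = w by apply/funext => s; exact: wE.
  rewrite -[X in is_derive _ _ X _]wE'.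
  rewrite -sub0r; apply: is_deriveB.
  by apply: is_derive_cprim => //; exact: (acc_continuous vB wB).
Qed.

Lemma geodesic_transport y (al : V) : `|y - x| <= rho / 2 ->
  exists g v w : R -> V,
    [/\ g 0 = x, g 1 = y, `|v 0| <= rho, w 0 = al &
      forall t : R, -1 < t < 2 -> [/\ `|g t - x| < r,
        is_derive t (1 : R) g (v t),
        is_derive t (1 : R) v (- Q (g t) (v t) (v t)) &
        is_derive t (1 : R) w (- Q (g t) (v t) (w t))]].
Proof.
move=> /geodesic_velocity[v vB [v1 dv]]; have [w w0 dw] := parallel_field al vB.
have vc := bounded_lip_continuous vB.
exists (fun t => x + vprim v t), v, w; split=> // [||t t12].
- by rewrite vprim0 addr0.
- by have [vr _] := vB.
have posE : x + vprim v t = pos v t.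
  by rewrite /pos /cprim clamp_id//; case/andP: t12 => *; exact: ltW.
rewrite posE; split; [exact: pos_near| |exact: dv|exact: dw].
rewrite -[v t]add0r; apply: is_deriveD.
by apply: is_derive_vprim => //; case/andP: t12 => *; lra.
Qed.

End GeodesicEquation.

(** * Locally Lipschitz functions *)

Section LocallyLipschitz.
Context {R : realType} {V : normedModType R}.
Implicit Types (f g : V -> R) (x y z v : V).

(** Both points range independently over neighbourhoods of [x], so this is a Lipschitz bound on a
    whole neighbourhood; as a filter statement it combines under sums and products without explicit
    radii. *)
Definition loc_lip x f : Prop := exists K : R,
  \forall p \near filter_prod (nbhs x) (nbhs x),
    `|f p.1 - f p.2| <= K * `|p.1 - p.2|.

Let cvg_pair1 x f : {for x, continuous f} ->
  f p.1 @[p --> filter_prod (nbhs x) (nbhs x)] --> f x.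
Proof.
by move=> cf; apply: (@cvg_comp _ _ _ fst f _ (nbhs x) _ cvg_fst cf).
Qed.

Let cvg_pair2 x f : {for x, continuous f} ->
  f p.2 @[p --> filter_prod (nbhs x) (nbhs x)] --> f x.
Proof.
by move=> cf; apply: (@cvg_comp _ _ _ snd f _ (nbhs x) _ cvg_snd cf).
Qed.

Lemma loc_lip_continuous x f : loc_lip x f -> {for x, continuous f}.
Proof.
move=> [K fK]; apply/cvgrPdist_lt => e e0.
have xx : (x, y) @[y --> x] --> filter_prod (nbhs x) (nbhs x).
  by apply: cvg_pair; [exact: cvg_cst|exact: cvg_id].
have K1 : 0 < `|K| + 1 by rewrite ltr_wpDl.
near=> y; have fy : `|f x - f y| <= K * `|x - y|.
  by near: y; exact: (xx _ fK).
apply: le_lt_trans fy _; apply: (@le_lt_trans _ _ ((`|K| + 1) * `|x - y|)).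
  by rewrite ler_wpM2r// (le_trans (ler_norm K))// lerDl.
rewrite -ltr_pdivlMl//; near: y.
by apply: (@cvgr_dist_lt _ V); rewrite // mulr_gt0// invr_gt0.
Unshelve. all: by end_near. Qed.

Lemma loc_lip_near_eq x f g : (\forall y \near x, f y = g y) ->
  loc_lip x f -> loc_lip x g.
Proof.
move=> fg [K fK]; exists K; near=> p.
have <- : f p.1 = g p.1 by near: p; exact: filter_prod1 fg.
have <- : f p.2 = g p.2 by near: p; exact: filter_prod2 fg.
by near: p.
Unshelve. all: by end_near. Qed.

Lemma loc_lip_ball x f (K r : R) : 0 < r ->
  (forall y z, `|x - y| < r -> `|x - z| < r -> `|f y - f z| <= K * `|y - z|) ->
  loc_lip x f.
Proof.
move=> r0 fK; have rx : \forall y \near x, `|x - y| < r.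
  by have := nbhsx_ballx x r r0; rewrite -ball_normE.
by exists K; near=> p; apply: fK; near: p;
  [exact: filter_prod1 rx|exact: filter_prod2 rx].
Unshelve. all: by end_near. Qed.

Lemma loc_lip_cst x (c : R) : loc_lip x (fun=> c).
Proof. by exists 0; near=> p; rewrite subrr normr0 mul0r.
Unshelve. all: by end_near. Qed.

Lemma loc_lipD x f g : loc_lip x f -> loc_lip x g ->
  loc_lip x (fun y => f y + g y).
Proof.
move=> [K fK] [L gL]; exists (K + L); near=> p.
rewrite opprD addrACA mulrDl; apply: le_trans (ler_normD _ _) _.
by apply: lerD; near: p.
Unshelve. all: by end_near. Qed.

Lemma loc_lipM x f g : loc_lip x f -> loc_lip x g ->
  loc_lip x (fun y => f y * g y).
Proof.
move=> fl gl; have cf := loc_lip_continuous fl.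
have cg := loc_lip_continuous gl.
move: fl gl => [K fK] [L gL].
exists ((`|f x| + 1) * L + (`|g x| + 1) * K); near=> p.
have -> : f p.1 * g p.1 - f p.2 * g p.2 =
  f p.1 * (g p.1 - g p.2) + g p.2 * (f p.1 - f p.2) by ring.
rewrite mulrDl -!mulrA; apply: le_trans (ler_normD _ _) _.
rewrite !normrM; apply: lerD; apply: ler_pM => //.
- near: p; apply: cvgr_le; first exact: cvg_norm (cvg_pair1 cf).
  by rewrite ltrDl.
- by near: p.
- near: p; apply: cvgr_le; first exact: cvg_norm (cvg_pair2 cg).
  by rewrite ltrDl.
- by near: p.
Unshelve. all: by end_near. Qed.

Lemma loc_lip_inv x f : f x != 0 -> loc_lip x f ->
  loc_lip x (fun y => (f y)^-1).
Proof.
move=> fx0 fl; have cf := loc_lip_continuous fl; move: fl => [K fK].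
(* Near [x] the values of [f] exceed [e] in absolute value, so the denominators in the difference of
   inverses are at least [e * e]. *)
pose e := `|f x| / 2; have e0 : 0 < e by rewrite divr_gt0// normr_gt0.
have ef : e < `|f x| by rewrite ltr_pdivrMr// ltr_pMr ?normr_gt0// ltr1n.
exists (K / (e * e)); near=> p.
have e1 : e < `|f p.1|.
  by near: p; apply: cvgr_gt; [exact: cvg_norm (cvg_pair1 cf)|].
have e2 : e < `|f p.2|.
  by near: p; apply: cvgr_gt; [exact: cvg_norm (cvg_pair2 cf)|].
have p1 : f p.1 != 0 by rewrite -normr_gt0 (lt_trans e0).
have p2 : f p.2 != 0 by rewrite -normr_gt0 (lt_trans e0).
have -> : (f p.1)^-1 - (f p.2)^-1 = (f p.2 - f p.1) / (f p.1 * f p.2).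
  by field; rewrite ?p1 ?p2.
rewrite normrM normfV normrM mulrAC; apply: ler_pM => //.
- by rewrite distrC; near: p.
- by rewrite lef_pV2 ?posrE ?mulr_gt0// ?normr_gt0// ler_pM// ltW.
Unshelve. all: by end_near. Qed.

Lemma loc_lip_sum (I : Type) (s : seq I) x (F : I -> V -> R) :
  (forall i, loc_lip x (F i)) -> loc_lip x (fun y => \sum_(i <- s) F i y).
Proof.
move=> Fl; elim: s => [|i s IH].
  rewrite (_ : (fun=> _) = fun=> 0); first exact: loc_lip_cst.
  by apply/funext => y; rewrite big_nil.
rewrite (_ : (fun=> _) = fun y => F i y + \sum_(j <- s) F j y).
  exact: loc_lipD.
by apply/funext => y; rewrite big_cons.
Qed.

Lemma loc_lip_prod (I : Type) (s : seq I) x (F : I -> V -> R) :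
  (forall i, loc_lip x (F i)) -> loc_lip x (fun y => \prod_(i <- s) F i y).
Proof.
move=> Fl; elim: s => [|i s IH].
  rewrite (_ : (fun=> _) = fun=> 1); first exact: loc_lip_cst.
  by apply/funext => y; rewrite big_nil.
rewrite (_ : (fun=> _) = fun y => F i y * \prod_(j <- s) F j y).
  exact: loc_lipM.
by apply/funext => y; rewrite big_cons.
Qed.

Lemma loc_lip_det x m (A : V -> 'M[R]_m) :
  (forall i j, loc_lip x (fun y => A y i j)) -> loc_lip x (fun y => \det (A y)).
Proof.
move=> Al; apply: loc_lip_sum => s; apply: loc_lipM; first exact: loc_lip_cst.
exact: loc_lip_prod.
Qed.

Lemma loc_lip_invmx x m (A : V -> 'M[R]_m) i j : A x \in unitmx ->
  (forall i j, loc_lip x (fun y => A y i j)) ->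
  loc_lip x (fun y => invmx (A y) i j).
Proof.
rewrite unitmxE unitfE => detA Al; have dl := loc_lip_det Al.
apply: (@loc_lip_near_eq _ (fun y => (\det (A y))^-1 * \adj (A y) i j)).
  (* [invmx] returns a singular matrix unchanged, so the cofactor formula is valid only where the
     determinant is nonzero; by continuity this is a neighbourhood of [x]. *)
  have : \forall y \near x, \det (A y) != 0.
    have := loc_lip_continuous dl.
    move=> /(_ [set r | r != 0]); apply; exact: open_nbhs_nbhs.
  by apply: filterS => y dy; rewrite /invmx unitmxE unitfE dy [RHS]mxE.
apply: loc_lipM; first exact: loc_lip_inv.
rewrite (_ : (fun y => _) = fun y => cofactor (A y) j i); last first.
  by apply/funext => y; rewrite mxE.
apply: loc_lipM; first exact: loc_lip_cst.
apply: loc_lip_det => a b.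
rewrite (_ : (fun y => _) = fun y => A y (lift j a) (lift i b)).
  exact: Al.
by apply/funext => y; rewrite !mxE.
Qed.

End LocallyLipschitz.

Lemma near_eq_continuous (T U : topologicalType) (f g : T -> U) (y : T) :
  (\forall z \near y, f z = g z) ->
  {for y, continuous f} -> {for y, continuous g}.
Proof.
move=> fg cf; rewrite /prop_for /continuous_at -(nbhs_singleton fg).
by apply: cvg_trans cf; apply: near_eq_cvg.
Qed.

Section ContinuouslyDifferentiable.
Context {R : realType} {n : nat}.
Implicit Types (f : 'rV[R]_n -> R) (U : set 'rV[R]_n).

Lemma is_derive_line (V W : normedModType R) (f : V -> W) (z v : V) (t : R) :
  differentiable f (z + t *: v) ->
  is_derive t (1 : R) (fun s : R => f (z + s *: v)) ('D_v f (z + t *: v)).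
Proof.
move=> df.
have E : (fun h : R => h^-1 *: (((fun s : R => f (z + s *: v)) \o shift t)
      (h *: 1) - f (z + t *: v))) = (fun h : R =>
    h^-1 *: ((f \o shift (z + t *: v)) (h *: v) - f (z + t *: v))).
  apply/funext => h /=; congr (_ *: (f _ - _)).
  by rewrite scalerDl [h *: 1]mulr1 addrCA.
apply: DeriveDef; last by rewrite /derive E.
by rewrite /derivable E; exact: diff_derivable.
Qed.

Lemma derive_coord_le f (a v : 'rV[R]_n) (K : R) : differentiable f a ->
  (forall j, `|'D_(delta_mx 0 j) f a| <= K) -> `|'D_v f a| <= n%:R * K * `|v|.
Proof.
move=> df fK; rewrite deriveE// [in leLHS](row_sum_delta v) linear_sum.
apply: le_trans (ler_norm_sum _ _ _) _.
have -> : n%:R * K * `|v| = \sum_(j < n) (K * `|v|).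
  by rewrite sumr_const card_ord -mulrA mulr_natl.
apply: ler_sum => j _; rewrite linearZ /= normrM mulrC ler_pM//.
  by rewrite -deriveE.
exact: mx_entry_le.
Qed.

(** Continuous partial derivatives are bounded on a small ball. Balls are convex, so the mean value
    theorem applies along the segment between two points of it. *)
Lemma loc_lip_C1 f U x : open U -> U x ->
  (forall y, U y -> differentiable f y) ->
  (forall j y, U y -> {for y, continuous ('D_(delta_mx 0 j) f)}) ->
  loc_lip x f.
Proof.
move=> oU Ux df cf.
pose K := \sum_j `|'D_(delta_mx 0 j) f x| + 1.
have KP j : `|'D_(delta_mx 0 j) f x| < K.
  rewrite /K (bigD1 j)//= -addrA ltrDl ltr_wpDl// sumr_ge0//.
have /nbhs_ballP[r /= r0 rP] : \forall y \near x,
    U y /\ forall j, `|'D_(delta_mx 0 j) f y| <= K.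
  near=> y; split; first by near: y; exact: open_nbhs_nbhs.
  near: y; apply: filter_forall => j; apply: cvgr_le (KP j).
  by apply: cvg_norm; exact: cf.
apply: (@loc_lip_ball _ _ _ _ (n%:R * K) r) => // y z xy xz.
pose v := y - z.
have seg t : 0 <= t <= 1 -> ball x r (z + t *: v).
  move=> /andP[t0 t1]; rewrite -ball_normE /=.
  have -> : x - (z + t *: v) = (1 - t) *: (x - z) + t *: (x - y).
    by apply/rowP => j; rewrite !mxE; ring.
  apply: le_lt_trans (ler_normD _ _) _; rewrite !normrZ.
  rewrite (ger0_norm t0) (@ger0_norm _ (1 - t)) ?subr_ge0//.
  have [->|t1'] := eqVneq t 1; first by rewrite subrr mul0r mul1r add0r.
  have t1'' : 0 < 1 - t by rewrite subr_gt0 lt_neqAle t1'.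
  have := ler_wpM2l t0 (ltW xy); have := xz; rewrite -(ltr_pM2l t1''); lra.
have := @is_derive_lipschitz R (fun t => f (z + t *: v))
  (fun t => 'D_v f (z + t *: v)) 0 1 (n%:R * K * `|v|) ler01.
rewrite scale1r scale0r addr0 {1}/v [z + (y - z)]addrC subrK subr0 mulr1.
apply => t t01.
- by apply: is_derive_line; apply: df; case: (rP _ (seg t t01)).
- have [Ut Kt] := rP _ (seg t t01).
  by apply: derive_coord_le => //; exact: df.
Unshelve. all: by end_near. Qed.

Lemma loc_lip_Ck_entry p q (h : 'rV[R]_n -> 'M[R]_(p, q)) U x i j :
  open U -> U x -> Ck_on 1 U h -> loc_lip x (fun z => h z i j).
Proof.
move=> oU Ux [dh ch]; apply: (loc_lip_C1 oU Ux) => [y Uy|c y Uy].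
  apply: (@differentiable_comp _ _ _ _ h (fun A : 'M[R]_(p, q) => A i j)).
    exact: dh.
  exact: differentiable_coord.
have cD : {for y, continuous (fun z => ('D_(delta_mx 0 c) h z) i j)}.
  apply: (@continuous_comp _ _ _ ('D_(delta_mx 0 c) h)
    (fun A : 'M[R]_(p, q) => A i j)); first exact: ch.
  exact: coord_continuous.
have E : \forall z \near y, ('D_(delta_mx 0 c) h z) i j =
    'D_(delta_mx 0 c) (fun z => h z i j) z.
  have : \forall z \near y, U z by exact: open_nbhs_nbhs.
  apply: filterS => z Uz; rewrite derive_mx ?mxE//.
  by apply: diff_derivable; exact: dh.
exact: near_eq_continuous E cD.
Qed.

End ContinuouslyDifferentiable.

(** * Charts and Christoffel symbols *)

(** Finiteness of [I] yields a common constant, a sum that dominates every [K i] and every |F i x| +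
    1, and a common ball inside all the neighbourhoods involved. *)
Lemma loc_lip_family {R : realType} {V : normedModType R} (I : finType)
    (F : I -> V -> R) (x : V) : (forall i, loc_lip x (F i)) ->
  exists C r : R, [/\ 0 <= C, 0 < r,
    forall i z, `|z - x| < r -> `|F i z| <= C &
    forall i z z', `|z - x| < r -> `|z' - x| < r ->
      `|F i z - F i z'| <= C * `|z - z'|].
Proof.
move=> Fl; have /choice[K FK] := Fl.
pose C := \sum_i (`|K i| + (`|F i x| + 1)).
have CP i : `|K i| + (`|F i x| + 1) <= C.
  by rewrite /C (bigD1 i)//= lerDl sumr_ge0// => j _; rewrite !addr_ge0.
have Fbd : \forall z \near x, forall i, `|F i z| <= C.
  apply: filter_forall => i; apply: (@filterS _ (nbhs x) _
      (fun z => `|F i z| <= `|F i x| + 1)) => [z|].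
    by move=> /le_trans; apply; apply: le_trans (CP i); rewrite lerDr.
  apply: cvgr_le; first exact: cvg_norm (loc_lip_continuous (Fl i)).
  by rewrite ltrDl.
have [[A B]/= [Ax Bx] ABP] : \forall p \near filter_prod (nbhs x) (nbhs x),
    forall i, `|F i p.1 - F i p.2| <= K i * `|p.1 - p.2|.
  by apply: filter_forall.
have /nbhs_ballP[r /= r0 rP] : \forall z \near x,
    [/\ A z, B z & forall i, `|F i z| <= C].
  near=> z; split; [by near: z|by near: z|by near: z].
exists C, r; split=> // [|i z|i z z'].
- by rewrite sumr_ge0// => j _; rewrite !addr_ge0.
- by rewrite distrC => zx; have [|_ _] := rP z; rewrite -?ball_normE//; apply.
- rewrite distrC (distrC z') => zx z'x.
  have [|Az _ _] := rP z; first by rewrite -ball_normE.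
  have [|_ Bz' _] := rP z'; first by rewrite -ball_normE.
  apply: le_trans (ABP (z, z') (conj Az Bz') i) _; rewrite ler_wpM2r//=.
  by apply: le_trans (CP i); rewrite (le_trans (ler_norm _))// lerDl addr_ge0.
Unshelve. all: by end_near. Qed.

Lemma derive_comp {R : realType} {U V W : normedModType R} (f : U -> V)
    (g : V -> W) (x v : U) : differentiable f x -> differentiable g (f x) ->
  'D_('D_v f x) g (f x) = 'D_v (g \o f) x.
Proof.
move=> df dg; rewrite (deriveE _ df) (deriveE _ dg) deriveE.
  by rewrite [RHS](congr1 (@^~ v) (diff_comp df dg)).
exact: differentiable_comp.
Qed.

Section Charts.
Context {R : realType} {n : nat} (M : smoothManifold R n).
Implicit Types (i j : chart_index M) (q : M).
Local Notation img i := (chart i @` dom i).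

Lemma chart_invK i z : img i z -> chart i (chart_inv i z) = z.
Proof. by move=> [q iq <-]; rewrite chartK. Qed.

Lemma dom_chart_inv i z : img i z -> dom i (chart_inv i z).
Proof. by move=> [q iq <-]; rewrite chartK. Qed.

Lemma img_chart i q : dom i q -> img i (chart i q).
Proof. by exists q. Qed.

Lemma near_img i z : img i z -> \forall y \near z, img i y.
Proof.
by move=> iz; apply: open_nbhs_nbhs; split => //; exact: chart_image_open.
Qed.

(** Near [chart (chart_at q) q] the transition map from this chart to itself is the identity; this
    is what makes the encoding of tangent vectors by preferred coordinates consistent. *)
Lemma tvector_chart_at q a : tvector (chart_at q) q a = a.
Proof.
rewrite /tvector -[RHS](@derive_id R _ (chart (chart_at q) q) a).
apply: near_eq_derive.
have := near_img (img_chart (dom_chart_at q)).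
by apply: filterS => z iz; rewrite /= chart_invK.
Qed.

(** The transition maps between chart [i] and the preferred chart are mutually inverse near the
    point, so by the chain rule their derivatives compose to the identity. *)
Lemma tvectorK i q : dom i q -> cancel (tvector i q) (tcoord i q).
Proof.
move=> iq a; rewrite /tcoord /tvector.
set j := chart_at q; have jq : dom j q := dom_chart_at q.
have [dij _] := transition_smooth i j 1.
have [dji _] := transition_smooth j i 1.
have {}dij : differentiable (chart j \o chart_inv i) (chart i q).
  by apply: dij; exists q.
have {}dji : differentiable (chart i \o chart_inv j) (chart j q).
  by apply: dji; exists q.
have E : (chart j \o chart_inv i) (chart i q) = chart j q by rewrite /= chartK.
rewrite -E in dji *; rewrite (derive_comp a dij dji).
rewrite -[RHS](@derive_id R _ (chart i q) a); apply: near_eq_derive.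
have jnear : \forall z \near chart i q, dom j (chart_inv i z).
  apply: (chart_inv_continuous (img_chart iq)); rewrite chartK//.
  by apply: open_nbhs_nbhs; split => //; exact: dom_open.
have := near_img (img_chart iq); apply: filterS2 jnear => z jz iz.
by rewrite /= chartK// chart_invK.
Qed.

End Charts.

Section Christoffel.
Context {R : realType} {n : nat} (M : riemannianManifold R n) (p : M).
Let i := chart_at p.
Let x := chart i p.

Lemma metric_mx_unit : metric_mx p \in unitmx.
Proof.
rewrite -row_free_unit -kermx_eq0; apply: contraT => /rowV0Pn[u].
move=> /sub_kermxP uG u0; have := metric_pos p u0.
by rewrite uG mul0mx mxE ltxx.
Qed.

Lemma local_metric_chart_at : local_metric (@metric_mx R n M) i x = metric_mx p.
Proof.
apply/matrixP => a b; rewrite /local_metric mxE /x chartK; last first.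
  exact: dom_chart_at.
by rewrite !tvector_chart_at -rowE trmx_delta -colE !mxE.
Qed.

(** The symbols are polynomial in the inverse metric and the first derivatives of the metric. The
    metric is C^2, so its entries and their first derivatives are C^1 and hence locally Lipschitz;
    inverting is harmless since the Gram matrix at [p] is invertible. *)
Lemma loc_lip_christoffel k a b : loc_lip x (fun z => christoffel i z k a b).
Proof.
pose U := chart i @` dom i.
have oU : open U by exact: chart_image_open.
have Ux : U x by apply: img_chart; exact: dom_chart_at.
have gs := metric_smooth i.
have gl c d : loc_lip x (fun z => local_metric (@metric_mx R n M) i z c d).
  exact: (loc_lip_Ck_entry _ _ oU Ux (gs 1%N)).
have dgl e c d : loc_lip x
    (fun z => 'D_(delta_mx 0 e) (local_metric (@metric_mx R n M) i) z c d).
  by apply: (loc_lip_Ck_entry _ _ oU Ux); have [_] := gs 2%N; apply.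
apply: loc_lipM; first exact: loc_lip_cst.
apply: loc_lip_sum => l; apply: loc_lipM.
  apply: loc_lip_invmx => //.
  by rewrite local_metric_chart_at; exact: metric_mx_unit.
apply: loc_lipD; first exact: loc_lipD.
rewrite (_ : (fun y => _) = fun y => (-1) *
    'D_(delta_mx 0 l) (local_metric (@metric_mx R n M) i) y a b).
  by apply: loc_lipM => //; exact: loc_lip_cst.
by apply/funext => y; rewrite mulN1r.
Qed.

(** The bilinear term Gamma(a, b) of the connection: a field [w] along a curve with velocity [v] is
    parallel when w' = - Gamma(v, w), and the geodesic equation is the case w = v. *)
Definition christoffel_form (j : chart_index M) (z a b : 'rV[R]_n) : 'rV[R]_n :=
  \row_k \sum_(c < n) \sum_(d < n) christoffel j z k c d * a 0 c * b 0 d.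

Lemma christoffel_formBl j z a a' b :
  christoffel_form j z (a - a') b =
  christoffel_form j z a b - christoffel_form j z a' b.
Proof.
apply/rowP => k; rewrite !mxE -sumrB; apply: eq_bigr => c _.
by rewrite -sumrB; apply: eq_bigr => d _; rewrite !mxE; ring.
Qed.

Lemma christoffel_formBr j z a b b' :
  christoffel_form j z a (b - b') =
  christoffel_form j z a b - christoffel_form j z a b'.
Proof.
apply/rowP => k; rewrite !mxE -sumrB; apply: eq_bigr => c _.
by rewrite -sumrB; apply: eq_bigr => d _; rewrite !mxE; ring.
Qed.

Lemma sum_form_le (G : 'I_n -> 'I_n -> R) (C : R) (a b : 'rV[R]_n) : 0 <= C ->
  (forall c d, `|G c d| <= C) ->
  `|\sum_c \sum_d G c d * a 0 c * b 0 d| <= n%:R * (n%:R * C) * `|a| * `|b|.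
Proof.
move=> C0 GC; apply: le_trans (ler_norm_sum _ _ _) _.
have -> : n%:R * (n%:R * C) * `|a| * `|b| =
    \sum_(c < n) \sum_(d < n) C * `|a| * `|b|.
  by rewrite !sumr_const !card_ord -mulrnA -[RHS]mulr_natl natrM; ring.
apply: ler_sum => c _; apply: le_trans (ler_norm_sum _ _ _) _.
apply: ler_sum => d _; rewrite !normrM.
by rewrite !ler_pM ?mulr_ge0//; exact: mx_entry_le.
Qed.

Lemma christoffel_form_bounds : exists C r : R, [/\ 0 <= C, 0 < r,
  forall z a b, `|z - x| < r -> `|christoffel_form i z a b| <= C * `|a| * `|b| &
  forall z z' a b, `|z - x| < r -> `|z' - x| < r ->
    `|christoffel_form i z a b - christoffel_form i z' a b|
      <= C * `|z - z'| * `|a| * `|b|].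
Proof.
have [|C [r [C0 r0 Cle Clip]]] := @loc_lip_family R 'rV[R]_n
  ('I_n * 'I_n * 'I_n)%type (fun t z => christoffel i z t.1.1 t.1.2 t.2) x.
  by move=> t; exact: loc_lip_christoffel.
exists (n%:R * (n%:R * C)), r; split=> // [|z a b zx|z z' a b zx z'x].
- by rewrite !mulr_ge0.
- apply: row_norm_le => [|k]; first by rewrite !mulr_ge0.
  by rewrite mxE; apply: sum_form_le => // c d; exact: (Cle (k, c, d)).
- have -> : n%:R * (n%:R * C) * `|z - z'| = n%:R * (n%:R * (C * `|z - z'|)).
    by rewrite -!mulrA.
  apply: row_norm_le => [|k]; first by rewrite !mulr_ge0.
  rewrite !mxE -sumrB (_ : \sum_(_ < n) _ = \sum_(c < n) \sum_(d < n)
     (christoffel i z k c d - christoffel i z' k c d) * a 0 c * b 0 d).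
    apply: sum_form_le => [|c d]; first by rewrite mulr_ge0.
    exact: (Clip (k, c, d)).
  apply: eq_bigr => c _; rewrite -sumrB; apply: eq_bigr => d _.
  by rewrite !mulrBl.
Qed.

End Christoffel.

(** * Short geodesics from a point to its neighbours *)

Section ShortGeodesics.
Context {R : realType} {n : nat} (M : riemannianManifold R n).

Lemma tnorm_le (p : M) : exists2 K : R, 0 < K &
  forall u, tnorm p u <= K * `|u|.
Proof.
(* The quadratic form is at most K |u|^2. The summand 1 ensures K <= K^2, so the square root is at
   most K |u|. *)
pose K : R := 1 + n%:R * (n%:R * `|metric_mx p|).
have K1 : 1 <= K by rewrite lerDl !mulr_ge0.
have K0 : 0 < K by exact: lt_le_trans ltr01 K1.
exists K => // u; rewrite /tnorm -[leRHS]ger0_norm; last first.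
  by rewrite mulr_ge0// ltW.
rewrite -sqrtr_sqr ler_wsqrtr// (le_trans (ler_norm _))//.
have -> : (u *m metric_mx p *m u^T) 0 0 =
    \sum_c \sum_d metric_mx p c d * u 0 c * u 0 d.
  rewrite exchange_big mxE; apply: eq_bigr => d _.
  by rewrite !mxE mulr_suml; apply: eq_bigr => c _; rewrite [_ * u 0 c]mulrC.
apply: le_trans (sum_form_le u u _ (mx_entry_le (metric_mx p))) _ => //.
rewrite exprMn -mulrA; apply: ler_pM; rewrite ?mulr_ge0//.
apply: (@le_trans _ _ K); first by rewrite lerDr.
by rewrite expr2 ler_peMr// ltW.
Qed.

(** Lifts a solution of the equations in a chart to the manifold. On the image of the chart [chart]
    undoes [chart_inv] and [tcoord] undoes [tvector], so near each time the coordinate derivatives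
    are the given ones. *)
Lemma exp_transport_coordinates (i : chart_index M) (g v w : R -> 'rV[R]_n) :
  (forall t : R, -1 < t < 2 -> [/\ (chart i @` dom i) (g t),
     is_derive t (1 : R) g (v t),
     is_derive t (1 : R) v (- christoffel_form i (g t) (v t) (v t)) &
     is_derive t (1 : R) w (- christoffel_form i (g t) (v t) (w t))]) ->
  exp_transport (chart_inv i (g 0)) (tvector i (chart_inv i (g 0)) (v 0))
    (tvector i (chart_inv i (g 0)) (w 0)) (chart_inv i (g 1))
    (tvector i (chart_inv i (g 1)) (w 1)).
Proof.
move=> eqns; pose gam t := chart_inv i (g t).
have itv (t : R) : t \in `]-1, 1 + 1[ -> -1 < t < 2 by rewrite in_itv.
have img (t : R) : -1 < t < 2 -> (chart i @` dom i) (g t) by case/eqns.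
have domg (t : R) : -1 < t < 2 -> dom i (gam t).
  by move=> /img; exact: dom_chart_inv.
have chartg (t : R) : -1 < t < 2 -> chart i (gam t) = g t.
  by move=> /img; exact: chart_invK.
have near_itv (t : R) : -1 < t < 2 -> \forall s \near t, -1 < s < 2.
  move=> t12; have : \forall s \near t, s \in `]-1, 2[.
    by apply: near_in_itvoo; rewrite in_itv.
  by apply: filterS => s; rewrite in_itv.
have cgam (t : R) : -1 < t < 2 -> {for t, continuous gam}.
  move=> t12; have [gt dg _ _] := eqns t t12.
  apply: (@continuous_comp _ _ _ g (chart_inv i)).
    exact: is_derive_continuous dg.
  exact: chart_inv_continuous.
have dgam (t : R) : -1 < t < 2 -> is_derive t (1 : R) (chart i \o gam) (v t).
  move=> t12; have [_ dg _ _] := eqns t t12.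
  apply: near_eq_is_derive dg; apply: filterS (near_itv t t12) => s s12.
  by rewrite /= chartg.
have par (z : R -> 'rV[R]_n) (t : R) : -1 < t < 2 ->
    is_derive t (1 : R) z (- christoffel_form i (g t) (v t) (z t)) ->
    parallel_at gam (fun s => tvector i (gam s) (z s)) t.
  move=> t12 dz; exists i, (v t); split; [exact: domg|exact: cgam|exact: dgam|].
  rewrite tvectorK ?chartg//; last exact: domg.
  apply: near_eq_is_derive dz; apply: filterS (near_itv t t12) => s s12.
  by rewrite tvectorK//; exact: domg.
(* The margin 1 makes the required interval exactly the one from -1 to 2 on which the equations
   hold. *)
exists 1, gam, (fun s => tvector i (gam s) (v s)),
  (fun s => tvector i (gam s) (w s)).
split=> // t /itv t12; have [_ _ dv dw] := eqns t t12; last exact: par.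
split; last exact: par.
exists i; split; [exact: domg|exact: cgam|].
by rewrite tvectorK; [exact: dgam|exact: domg].
Qed.

(** The coordinate geodesic to [chart i q] has initial velocity of norm at most [rho], so shrinking
    [rho] makes [u] as short as desired. *)
Lemma exp_transport_near (p : M) (al : 'rV[R]_n) (e : R) : 0 < e ->
  \forall q \near p, exists u be, tnorm p u <= e /\ exp_transport p u al q be.
Proof.
move=> e0; pose i := chart_at p; pose x := chart i p.
have ip : dom i p := dom_chart_at p.
have [C [r [C0 r0 Gle Glip]]] := christoffel_form_bounds p.
have [K K0 tK] := tnorm_le p.
have /nbhs_ballP[s /= s0 sU] := near_img (img_chart ip).
pose r' := Num.min r s.
have r'0 : 0 < r' by rewrite lt_min r0.
have r'r z : `|z - x| < r' -> `|z - x| < r by rewrite lt_min => /andP[].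
(* The last three entries give in turn [2 * rho < r'], which keeps the curve inside the chart image
   and where the Christoffel bounds hold, then [C * rho <= 32^-1] for the contractions, and
   [K * rho <= e] for the length of [u]. *)
pose rho := Num.min (Num.min 1 (r' / 3)) (Num.min (32^-1 / (C + 1)) (e / K)).
have C1 : 0 < C + 1 by rewrite ltr_wpDl.
have rho0 : 0 < rho by rewrite !lt_min ltr01 !divr_gt0// invr_gt0.
have : rho <= rho by [].
rewrite {2}/rho !le_min => /andP[/andP[rho1 rhor] /andP[rhoC rhoe]].
have {}rhor : 2 * rho < r' by lra.
have {}rhoC : C * rho <= 32^-1.
  move: rhoC; rewrite ler_pdivlMr// => rhoC; apply: le_trans rhoC.
  by rewrite mulrC ler_wpM2l ?lerDl// ltW.
move: rhoe; rewrite ler_pdivlMr// mulrC => rhoe.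
have near_x : \forall q \near p, `|chart i q - x| <= rho / 2.
  near=> q; rewrite distrC ltW//; near: q.
  have := chart_continuous ip; move=> /cvgrPdist_lt; apply.
  by rewrite divr_gt0.
near=> q.
have iq : dom i q.
  by near: q; apply: open_nbhs_nbhs; split => //; exact: dom_open.
have xq : `|chart i q - x| <= rho / 2 by near: q.
have [g [v [w [g0 g1 v0 w0 eqns]]]] := geodesic_transport
  (christoffel_formBl i) (christoffel_formBr i) C0
  (fun z a b h => Gle z a b (r'r z h))
  (fun z z' a b h h' => Glip z z' a b (r'r z h) (r'r z' h'))
  rho0 rho1 rhor rhoC al xq.
exists (v 0), (tvector i q (w 1)); split.
  by apply: le_trans (tK _) _; apply: le_trans rhoe; rewrite ler_wpM2l// ltW.
have := @exp_transport_coordinates i g v w.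
rewrite g0 g1 w0 /x !chartK// !tvector_chart_at; apply => t t12.
have [gx dg dv dw] := eqns t t12; split=> //; apply: sU.
by rewrite -ball_normE /= distrC; move: gx; rewrite lt_min => /andP[].
Unshelve. all: by end_near. Qed.

End ShortGeodesics.

(** * Chains *)

Section ChainNorm.
Context {R : realType} {n : nat} {M : riemannianManifold R n}.

Lemma tnorm_ge0 (p : M) u : 0 <= tnorm p u.
Proof. exact: sqrtr_ge0. Qed.

(** The decomposition of [A] into this single term competes in the infimum, which is bounded below
    by 0 because all terms have nonnegative value. *)
Lemma B1norm_le (A : chain M) (r : R) : weighted_term (A, r) -> B1norm A <= r.
Proof.
move=> Ar; apply: ge_inf.
  exists 0 => _ [s [sw _ ->]]; rewrite big_seq sumr_ge0// => -[B b] /sw.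
  by case=> [[p [al [_ ->]]]|[p [u [al [q [be [_ [_ ->]]]]]]]];
    rewrite ?mulr_ge0// tnorm_ge0.
exists [:: (A, r)]; split; rewrite ?big_seq1// => x; rewrite inE => /eqP-> //.
Qed.

Lemma elemD (p : M) a b : elem p (a + b) = elem p a + elem p b.
Proof.
apply: val_inj; apply/funext => q /=; rewrite fctE.
by case: ifP; rewrite ?addr0.
Qed.

Lemma elemZ (p : M) c a : elem p (c *: a) = c *: elem p a.
Proof.
apply: val_inj; apply/funext => q /=; rewrite fctE.
by case: ifP; rewrite ?scaler0.
Qed.

Lemma chain_sum_elem (A : chain M) :
  A = \sum_(q <- fset_set [set q | A q != 0]) elem q (A q).
Proof.
have fA : finite_set [set q | A q != 0] by apply/asboolP; case: A.
apply: val_inj; apply/funext => q /=.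
have sumE (s : seq M) : val (\sum_(r <- s) elem r (A r)) q =
    \sum_(r <- s) (if q == r then A r else 0).
  elim: s => [|r s IH]; first by rewrite !big_nil.
  by rewrite !big_cons /= fctE -IH.
rewrite sumE; have [qA|qA] := boolP (q \in fset_set [set q | A q != 0]).
  rewrite (big_rem q)//= eqxx big_seq big1 ?addr0// => r.
  by rewrite rem_filter ?fset_uniq// mem_filter /= eq_sym => /andP[/negPf->].
rewrite big_seq big1 => [|r rA]; last first.
  by case: eqP => // qr; rewrite qr rA in qA.
apply/eqP; apply: contraNT qA => Aq0.
by rewrite in_fset_set//; exact: mem_set.
Qed.

Lemma form_chain_sum (om : M -> 'cV[R]_n) (A : chain M) :
  form_chain om A =
    \sum_(q <- fset_set [set q | A q != 0]) form_at om q (A q).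
Proof.
have fA : finite_set [set q | A q != 0] by apply/asboolP; case: A.
apply: fsbigTE => q; rewrite in_fset_set// => qA.
have -> : A q = 0 by apply/eqP; apply: contraNT qA => Aq0; exact: mem_set.
by rewrite /form_at mul0mx mxE.
Qed.

End ChainNorm.

(** * The vector field as a continuous map into the completion *)

Section PushedElements.
Context {R : realType} {n : nat} {M : riemannianManifold R n}.
Context (X : M -> 'rV[R]_n) (BM : B1completion M).

Definition field_point (q : M) : BM := B1incl BM (elem q (X q)).

Lemma field_point_dist p u q be (K : R) :
  exp_transport p u (X p) q be -> tnorm q (X q - be) <= K * tnorm p u ->
  `|field_point q - field_point p| <= (K + tnorm p (X p)) * tnorm p u.
Proof.
move=> pq Xq; rewrite /field_point -linearB.
have -> : elem q (X q) - elem p (X p) =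
    elem q (X q - be) + (elem q be - elem p (X p)).
  by rewrite addrA -elemD subrK.
rewrite linearD mulrDl; apply: le_trans (ler_normD _ _) _.
rewrite !B1incl_norm; apply: lerD.
  by apply: le_trans Xq; apply: B1norm_le; left; exists q, (X q - be).
rewrite mulrC; apply: B1norm_le; right.
by exists p, u, (X p), q, be.
Qed.

Lemma field_point_continuous : lipschitz_field X -> continuous field_point.
Proof.
move=> [K lipK] p; apply/cvgrPdist_le => e e0.
(* [K] may be negative and |X p| may vanish; the absolute value and the 1 make this sum a positive
   divisor. *)
have c0 : 0 < `|K| + tnorm p (X p) + 1.
  by rewrite ltr_wpDl// addr_ge0// tnorm_ge0.
have := @exp_transport_near R n M p (X p) (e / (`|K| + tnorm p (X p) + 1)).
rewrite divr_gt0// => /(_ isT); apply: filterS => q [u [be [ue pq]]].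
have Xq : tnorm q (X q - be) <= `|K| * tnorm p u.
  apply: le_trans (lipK _ _ _ _ pq) _.
  by rewrite ler_wpM2r ?tnorm_ge0// ler_norm.
rewrite distrC; apply: le_trans (field_point_dist pq Xq) _.
apply: (@le_trans _ _ ((`|K| + tnorm p (X p) + 1) * tnorm p u)).
  by rewrite ler_wpM2r ?tnorm_ge0// lerDl.
by move: ue; rewrite ler_pdivlMr// mulrC.
Qed.

End PushedElements.

(** * Norming functionals *)

Section HahnBanach.
Context {R : realType} {V : normedModType R}.
Implicit Types (q : V -> R) (u v y z : V).

(** The bound by the norm is part of the notion, so that a linear member has norm at most 1.
    Homogeneity is stated as an inequality, which is easier to check for infima; [sublinearZ]
    recovers equality. *)
Definition sublinear q : Prop :=
  [/\ forall u v, q (u + v) <= q u + q v,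
      forall a v, 0 <= a -> q (a *: v) <= a * q v &
      forall v, q v <= `|v|].

Lemma sublinear_norm : sublinear (fun v => `|v|).
Proof.
by split=> // [u v|a v a0]; [exact: ler_normD|rewrite normrZ ger0_norm].
Qed.

Lemma sublinear0 q : sublinear q -> q 0 = 0.
Proof.
move=> [qD qZ _]; apply/eqP; rewrite eq_le.
have := qZ 0 0 (lexx 0); rewrite scale0r mul0r => -> /=.
by have := qD 0 0; rewrite addr0 -lerBlDl subrr.
Qed.

Lemma sublinearZ q a v : sublinear q -> 0 <= a -> q (a *: v) = a * q v.
Proof.
move=> sq; have [_ qZ _] := sq; rewrite le_eqVlt => /predU1P[<-|a0].
  by rewrite scale0r mul0r sublinear0.
apply/eqP; rewrite eq_le qZ ?(ltW a0)//= -ler_pdivlMl//.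
have := qZ a^-1 (a *: v); rewrite scalerA mulVf ?gt_eqF// scale1r.
by apply; rewrite invr_ge0 ltW.
Qed.

Lemma sublinear_ge q v : sublinear q -> - q (- v) <= q v.
Proof.
move=> sq; have [qD _ _] := sq.
by have := qD v (- v); rewrite subrr sublinear0//; lra.
Qed.

(* Replacing [q] by this functional lowers it in direction [- y] to [- q y]. *)
Definition lower q y v : R :=
  inf [set q (v + t *: y) - t * q y | t in [set t : R | 0 <= t]].

Lemma lower_ge q y v (t : R) : sublinear q -> 0 <= t ->
  - q (- v) <= q (v + t *: y) - t * q y.
Proof.
move=> sq t0; have [qD _ _] := sq; rewrite -sublinearZ//.
by have := qD (v + t *: y) (- v); rewrite addrAC subrr add0r; lra.
Qed.

Lemma lower_le q y v (t : R) : sublinear q -> 0 <= t ->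
  lower q y v <= q (v + t *: y) - t * q y.
Proof.
move=> sq t0; apply: ge_inf; last by exists t.
by exists (- q (- v)) => _ [s /= s0 <-]; exact: lower_ge.
Qed.

Lemma le_lower q y v (c : R) :
  (forall t, 0 <= t -> c <= q (v + t *: y) - t * q y) -> c <= lower q y v.
Proof.
move=> h; apply: lb_le_inf; first by exists (q (v + 0 *: y) - 0 * q y), 0 => /=.
by move=> _ [t /= t0 <-]; exact: h.
Qed.

Lemma lower_le_id q y v : sublinear q -> lower q y v <= q v.
Proof.
move=> sq; have := lower_le y v sq (lexx 0).
by rewrite scale0r mul0r addr0 subr0.
Qed.

Lemma lower_opp q y : sublinear q -> lower q y (- y) <= - q y.
Proof.
move=> sq; have := lower_le y (- y) sq (@ler01 R).
by rewrite scale1r addNr mul1r sublinear0// sub0r.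
Qed.

(** The parameters t >= 0 are closed under addition and nonnegative scaling, so subadditivity and
    homogeneity pass from [q] to the infimum. *)
Lemma sublinear_lower q y : sublinear q -> sublinear (lower q y).
Proof.
move=> sq; have [qD qZ qn] := sq; split=> [u v|a v|v].
- rewrite -lerBlDr; apply: le_lower => t t0; rewrite lerBlDl -lerBlDr.
  apply: le_lower => s s0; rewrite lerBlDr.
  apply: le_trans (lower_le y (u + v) sq (addr_ge0 t0 s0)) _.
  have := qD (u + t *: y) (v + s *: y).
  by rewrite addrACA -scalerDl mulrDl; lra.
- rewrite le_eqVlt => /predU1P[<-|a0].
    rewrite scale0r mul0r -[leRHS](sublinear0 sq); exact: lower_le_id.
  rewrite -ler_pdivrMl//; apply: le_lower => t t0.
  rewrite ler_pdivrMl// mulrBr -(sublinearZ (v + t *: y) sq (ltW a0)).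
  rewrite scalerDr scalerA mulrA.
  by apply: lower_le => //; rewrite mulr_ge0// ltW.
- exact: le_trans (lower_le_id _ _ sq) (qn v).
Qed.

(** Zorn's lemma for the functionals below [q0] under the reversed pointwise order: the pointwise
    infimum of a nonempty totally ordered family is again sublinear and bounds the family from
    below. *)
Lemma sublinear_minimal q0 : sublinear q0 ->
  exists q, [/\ sublinear q, forall v, q v <= q0 v &
    forall q', sublinear q' -> (forall v, q' v <= q v) -> q' = q].
Proof.
move=> sq0; pose T := {q | sublinear q /\ forall v, q v <= q0 v}.
pose below (s t : T) := `[< forall v, sval t v <= sval s v >].
have T_eq (s t : T) : sval s = sval t -> s = t.
  case: s t => [s hs] [t ht] /= st; subst t; congr exist.
  exact: Prop_irrelevance.
have [||||t tmin] := @Zorn T below.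
- by move=> t; apply/asboolP.
- move=> r s t /asboolP rs /asboolP st; apply/asboolP => v.
  exact: le_trans (st v) (rs v).
- move=> s t /asboolP st /asboolP ts; apply: T_eq; apply/funext => v.
  by apply/eqP; rewrite eq_le ts st.
- move=> A Atot; have [[s0 As0]|A0] := pselect (A !=set0); last first.
    exists (exist _ q0 (conj sq0 (fun v => lexx (q0 v)))) => s As.
    by case: A0; exists s.
  pose m v := inf [set sval s v | s in A].
  have mle s v : A s -> m v <= sval s v.
    move=> As; apply: ge_inf; last by exists s.
    exists (- `|- v|) => _ [r _ <-]; have [sr _] := svalP r.
    by apply: le_trans _ (sublinear_ge v sr); rewrite lerN2; case: sr.
  have le_m (c : R) v : (forall s, A s -> c <= sval s v) -> c <= m v.
    move=> h; apply: lb_le_inf; first by exists (sval s0 v), s0.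
    by move=> _ [s As <-]; exact: h.
  have sm : sublinear m.
    split=> [u v|a v|v].
    - rewrite -lerBlDr; apply: (le_m) => s As; rewrite lerBlDl -lerBlDr.
      apply: (le_m) => r Ar; rewrite lerBlDr.
      (* The family is totally ordered, so the smaller of the two members chosen for [u] and [v] can
         be used for both, and its own subadditivity applies. *)
      have [/asboolP sr|/asboolP rs] := Atot _ _ As Ar.
        have [[rD _ _] _] := svalP r; apply: le_trans (mle _ _ Ar) _.
        by rewrite [leRHS]addrC (le_trans (rD u v))// lerD.
      have [[sD _ _] _] := svalP s; apply: le_trans (mle _ _ As) _.
      by rewrite [leRHS]addrC (le_trans (sD u v))// lerD.
    - rewrite le_eqVlt => /predU1P[<-|a0].
        rewrite scale0r mul0r; have [ss0 _] := svalP s0.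
        by rewrite -[leRHS](sublinear0 ss0) mle.
      rewrite -ler_pdivrMl//; apply: (le_m) => s As; rewrite ler_pdivrMl//.
      have [ss _] := svalP s.
      by rewrite -sublinearZ ?(ltW a0)// mle.
    - have [[_ _ sn] _] := svalP s0; exact: le_trans (mle _ _ As0) (sn v).
  have mq0 v : m v <= q0 v.
    by have [_ h] := svalP s0; exact: le_trans (mle _ _ As0) (h v).
  by exists (exist _ m (conj sm mq0)) => s As; apply/asboolP => v; exact: mle.
exists (sval t); have [st tq0] := svalP t; split=> // q' sq' q't.
have q'q0 v : q' v <= q0 v by exact: le_trans (q't v) (tq0 v).
rewrite -(tmin (exist _ q' (conj sq' q'q0)))//; exact/asboolP.
Qed.

(* A minimal sublinear functional is odd, because [lower] cannot decrease it. *)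
Lemma hahn_banach_norming z :
  exists ell : {linear V -> R^o}, ell z = `|z| /\ forall v, `|ell v| <= `|v|.
Proof.
(* Starting from the norm already lowered along [z] gives q (- z) <= - |z|; once [q] is known to be
   odd, this forces q z = |z|. *)
have [q [sq qle qmin]] := sublinear_minimal (sublinear_lower z sublinear_norm).
have qN y : q (- y) = - q y.
  apply/eqP; rewrite eq_le; apply/andP; split; last first.
    by have := sublinear_ge (- y) sq; rewrite opprK.
  have := lower_opp y sq.
  by rewrite (qmin _ (sublinear_lower y sq))// => v; exact: lower_le_id.
have [qD _ qn] := sq.
have qlin : linear (q : V -> R^o).
  have qA u v : q (u + v) = q u + q v.
    apply/eqP; rewrite eq_le qD /=.
    by have := qD (u + v) (- v); rewrite qN addrK; lra.
  move=> a u v; rewrite qA; congr (_ + _).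
  have [a0|a0] := leP 0 a; first exact: sublinearZ.
  have a'0 : 0 <= - a by rewrite oppr_ge0 ltW.
  by rewrite -[a]opprK scaleNr qN sublinearZ// -mulNr.
pose ell : {linear V -> R^o} := HB.pack (q : V -> R^o)
  (GRing.isLinear.Build _ _ _ _ (q : V -> R^o) qlin).
exists ell; split=> [|v]; rewrite /ell /=.
  apply/eqP; rewrite eq_le qn /= -lerN2 -qN.
  exact: le_trans (qle _) (lower_opp z sublinear_norm).
by rewrite ler_norml qn andbT -lerN2 opprK -qN -(normrN v) qn.
Qed.

End HahnBanach.

(** * Functionals evaluated on the pushed interval *)

Section PushedIntervalFunctional.
Context {R : realType} {n : nat} {M : riemannianManifold R n}.
Context (X : M -> 'rV[R]_n) (phi : M -> R -> M) (p : M).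
Context (BR : B1completion (real_line R)) (BM : B1completion M).
Context (F : {linear BR -> BM}).
Context (FP : is_pushforward X phi p F).

Lemma bounded_lipschitz_le (om : real_line R -> 'cV[R]_1) (L : R) :
  (forall (A : chain (real_line R)) r, weighted_term (A, r) ->
     `|form_chain om A| <= L * r) ->
  bounded_lipschitz om.
Proof.
move=> omL; apply: (@le_lt_trans _ _ L%:E); last exact: ltry.
rewrite /form_B1norm ge_max; apply/andP; split; apply: ub_ereal_sup.
  move=> _ [q [al [al1 ->]]]; rewrite lee_fin -[L]mulr1 -al1.
  by apply: omL; left; exists q, al.
move=> _ [q [u [al [r [be [qr al1 ->]]]]]]; rewrite lee_fin -[L]mulr1 -al1.
by apply: omL; right; exists q, u, al, r, be.
Qed.

(** The functional [ell \o F] on chains of the line comes from a 1-form [eta], its values on the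
    unit vectors. Since [F] is bounded and [ell] has norm at most 1, [eta] is bounded Lipschitz, so
    the property defining the interval chain applies to it. *)
Lemma pushed_interval (ell : {linear BM -> R^o}) (J : BR) (T : R) :
  (forall v, `|ell v| <= `|v|) -> is_interval_chain T J ->
  ell (F J) = \int[lebesgue_measure]_(t in `[0, T])
    ell (field_point X BM (phi p t)).
Proof.
move=> ell1 JT; have [cF Fp] := FP.
pose G : {linear BR -> R^o} := ell \o F.
pose eta (t : real_line R) : 'cV[R]_1 :=
  const_mx (G (B1incl BR (elem t (const_mx 1)))).
have [L FL] : exists L : R, forall z, `|F z| <= L * `|z|.
  have /linear_bounded_continuous/linear_boundedP := cF.
  by move=> /pinfty_ex_gt0[L _ FL]; exists L.
have cG : continuous G.
  move=> z; apply/cvgrPdist_lt => e e0.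
  have := cF z; move=> /cvgrPdist_lt /(_ e e0); apply: filterS => y.
  by apply: le_lt_trans; rewrite -!linearB; exact: ell1.
have etaG A : G (B1incl BR A) = form_chain eta A.
  rewrite form_chain_sum [in LHS](chain_sum_elem A) !linear_sum.
  apply: eq_bigr => q _.
  (* The tangent spaces of the line are one-dimensional, so the values of a linear functional on
     unit vectors determine it on all chains. *)
  have -> : A q = A q 0 0 *: const_mx 1.
    by apply/rowP => j; rewrite !mxE (ord1 j) mulr1.
  rewrite elemZ !linearZ /form_at /eta -scalemxAl !mxE big_ord1 !mxE mul1r.
  by [].
have eta_bl : bounded_lipschitz eta.
  apply: (@bounded_lipschitz_le _ `|L|) => A r Ar; rewrite -etaG /G /=.
  apply: le_trans (ell1 _) _; apply: le_trans (FL _) _.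
  apply: (@le_trans _ _ (`|L| * `|B1incl BR A|)).
    by rewrite ler_wpM2r// ler_norm.
  by rewrite ler_wpM2l// B1incl_norm B1norm_le.
have := JT eta G eta_bl (conj cG (fun A => etaG A)).
rewrite -[G J]/(ell (F J)) => ->.
apply: eq_Rintegral => t _.
rewrite /form_at /eta !mxE big_ord1 !mxE mul1r /G /= Fp mxE scale1r.
by [].
Qed.

End PushedIntervalFunctional.

(** * Time averages *)

Lemma cvg_sum_seq {R : realType} {V : normedModType R} (T I : Type)
    (F : set_system T) {FF : Filter F} (s : seq I) (f : I -> T -> V)
    (l : I -> V) : (forall i, f i x @[x --> F] --> l i) ->
  (\sum_(i <- s) f i x) @[x --> F] --> \sum_(i <- s) l i.
Proof.
move=> fl; elim: s => [|i s IH].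
  by rewrite big_nil; under eq_fun do rewrite big_nil; exact: cvg_cst.
by rewrite big_cons; under eq_fun do rewrite big_cons; exact: cvgD.
Qed.

Section TimeAverages.
Context {R : realType}.
Local Notation mu := lebesgue_measure.

Definition time_average (f : R -> R) (T : R) : R :=
  T^-1 * \int[mu]_(t in `[0, T]) f t.

Lemma time_averageD (f g : R -> R) (T : R) : continuous f -> continuous g ->
  time_average (fun t => f t + g t) T = time_average f T + time_average g T.
Proof.
move=> cf cg; rewrite /time_average RintegralD ?mulrDr//;
  exact: continuous_integrable_itv.
Qed.

Lemma time_averageB (f g : R -> R) (T : R) : continuous f -> continuous g ->
  time_average (fun t => f t - g t) T = time_average f T - time_average g T.
Proof.
move=> cf cg; rewrite /time_average RintegralB ?mulrBr//;
  exact: continuous_integrable_itv.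
Qed.

Lemma time_averageZ (f : R -> R) (c T : R) : continuous f ->
  time_average (fun t => f t * c) T = time_average f T * c.
Proof.
move=> cf; rewrite /time_average RintegralZr ?mulrA//.
exact: continuous_integrable_itv.
Qed.

Lemma time_average_sum (I : Type) (s : seq I) (f : I -> R -> R) (T : R) :
  (forall i, continuous (f i)) ->
  time_average (fun t => \sum_(i <- s) f i t) T =
  \sum_(i <- s) time_average (f i) T.
Proof.
move=> cf; elim: s => [|i s IH].
  rewrite big_nil /time_average; under eq_Rintegral do rewrite big_nil.
  by rewrite Rintegral_cst//= mul0r mulr0.
rewrite big_cons -IH -time_averageD//; last first.
  by move=> t; apply: cvg_sum_seq => j; exact: cf.
by congr (_ * _); apply: eq_Rintegral => t _; rewrite big_cons.
Qed.

Lemma time_average_le (f : R -> R) (c T : R) : continuous f -> 0 < T ->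
  (forall t, `|f t| <= c) -> `|time_average f T| <= c.
Proof.
move=> cf T0 fc; rewrite /time_average normrM gtr0_norm ?invr_gt0//.
rewrite ler_pdivrMl//.
apply: le_trans (le_normr_Rintegral _ _) _ => //.
  exact: continuous_integrable_itv.
have -> : T * c = \int[mu]_(t in `[0, T]) c.
  rewrite Rintegral_cst//= lebesgue_measure_itv/= lte_fin T0 /= subr0.
  exact: mulrC.
apply: le_Rintegral => //.
  apply: (@continuous_integrable_itv _ (fun t => `|f t|)) => t.
  by apply: cvg_norm; exact: cf.
by apply: (@continuous_integrable_itv _ (fun=> c)) => t; exact: cvg_cst.
Qed.

End TimeAverages.

(** Compactness covers the image of [C] by finitely many balls of radius e / 2 around values [C i];
    normalised tent functions of the distance to [C i] give the weights. The product inequality says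
    that [f i] vanishes where [C] is farther than [e] from [C i]. *)
Lemma partition_of_unity {R : realType} (K : topologicalType)
    (V : normedModType R) (C : K -> V) (e : R) :
  compact [set: K] -> continuous C -> 0 < e ->
  exists (s : seq K) (f : K -> K -> R),
    [/\ forall i, continuous (f i), forall i q, 0 <= f i q,
      forall q, \sum_(i <- s) f i q = 1 &
      forall i q, f i q * `|C q - C i| <= f i q * e].
Proof.
move=> cK cC e0; have e2 : 0 < e / 2 by rewrite divr_gt0.
have : compact (C @` setT).
  by apply: continuous_compact => //; exact: continuous_subspaceT.
rewrite compact_cover => /(_ _ setT (fun i : K => ball (C i) (e / 2))).
case=> [i _|_ [q _ <-]|s _ scover].
- exact: ball_open.
- by exists q => //; exact: ballxx.
pose h i q : R := Num.max 0 (e - `|C q - C i|).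
have h0 i q : 0 <= h i q by rewrite le_max lexx.
have ch i : continuous (h i).
  move=> q; apply: (@continuous_max R K (fun=> 0) (fun q => e - `|C q - C i|)).
    exact: cvg_cst.
  apply: cvgB; first exact: cvg_cst.
  by apply: cvg_norm; apply: cvgB; [exact: cC|exact: cvg_cst].
pose S q := \sum_(i <- s) h i q.
have S0 q : 0 < S q.
  have [|i /= iS] := scover (C q); first by exists q.
  rewrite -ball_normE /= distrC => qi.
  rewrite /S (big_rem i)//= ltr_pwDl ?sumr_ge0//.
  rewrite lt_max subr_gt0 (lt_trans qi) ?orbT//.
  by rewrite ltr_pdivrMr// ltr_pMr// ltr1n.
exists s, (fun i q => h i q / S q); split=> [i q|i q|q|i q].
- apply: cvgM; first exact: ch.
  apply: cvgV; first by rewrite gt_eqF.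
  by apply: cvg_sum_seq => j; exact: ch.
- by rewrite divr_ge0// ltW.
- by rewrite -mulr_suml; exact: divff (lt0r_neq0 (S0 q)).
- rewrite mulrAC [leRHS]mulrAC ler_pM2r ?invr_gt0//.
  rewrite /h; case: (leP 0 (e - `|C q - C i|)) => [qi|_]; last first.
    by rewrite !mul0r.
  by rewrite ler_wpM2l// -subr_ge0.
Qed.

(** * Convergence of the averages in the completion *)

Theorem theorem4p3p2 (R : realType) (n : nat) (M : riemannianManifold R n)
    (X : M -> 'rV[R]_n) (phi : M -> R -> M) (p : M)
    (BR : B1completion (real_line R)) (BM : B1completion M)
    (pushforward : {linear BR -> BM}) (interval_chain : R -> BR)
    (compactM : compact [set: M])
    (lipX : lipschitz_field X)
    (flowX : flow_of X phi)
    (pushforwardP : is_pushforward X phi p pushforward)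
    (interval_chainP : forall T : R, 0 < T ->
       is_interval_chain T (interval_chain T))
    (qrp : quasi_regular phi p) :
  exists Jp : BM,
    (T^-1 *: pushforward (interval_chain T)) @[T --> +oo] --> Jp.
Proof.
pose J T := T^-1 *: pushforward (interval_chain T).
pose C := field_point X BM; have cC : continuous C.
  exact: field_point_continuous.
have cphi : continuous (phi p) by move=> t; have [_ /(_ t)[i []]] := flowX p.
(* By completeness a Cauchy property suffices, and there the centre [l] may depend on [e]. *)
suff approx e : 0 < e -> exists l : BM, \forall T \near +oo, `|l - J T| < e.
  suff : cvg (J T @[T --> +oo]) by move=> /cvg_ex.
  apply: cauchy_cvg; apply: cauchy_exP => e /approx[l le].
  by exists l; apply: filterS le => T; rewrite -ball_normE.
move=> e0; have e2 : 0 < e / 2 by rewrite divr_gt0.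
have [s [f [cf f0 f1 fe]]] := partition_of_unity compactM cC e2.
pose g i t := f i (phi p t).
have cg i : continuous (g i).
  by move=> t; apply: continuous_comp; [exact: cphi|exact: cf].
pose a i T := time_average (g i) T.
(* Quasi-regularity is applied to the weights, which are continuous functions on the manifold. *)
have acvg i : exists l : R, a i T @[T --> +oo] --> l.
  by have /cvg_ex := qrp _ (cf i).
have /choice[b ab] := acvg.
pose G T : BM := \sum_(i <- s) a i T *: C i.
have Gcvg : G T @[T --> +oo] --> \sum_(i <- s) b i *: C i.
  by apply: cvg_sum_seq => i; apply: cvgZ; [exact: ab|exact: cvg_cst].
(* The norm is attained at a functional [ell] that depends on [T], whereas the resulting bound does
   not. Under [ell] both terms become time averages of real functions, so a bound on the integrands
   suffices. *)
have GJ T : 0 < T -> `|G T - J T| <= e / 2.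
  move=> T0; have [ell [<- ell1]] := hahn_banach_norming (G T - J T).
  pose L t := ell (C (phi p t)).
  have cL : continuous L.
    move=> t; apply/cvgrPdist_lt => d d0.
    have cCphi : {for t, continuous (C \o phi p)}.
      by apply: continuous_comp; [exact: cphi|exact: cC].
    have := cCphi; move=> /cvgrPdist_lt /(_ d d0); apply: filterS => u.
    by apply: le_lt_trans; rewrite /L -linearB; exact: ell1.
  have JE : ell (J T) = time_average L T.
    rewrite /J linearZ /=.
    by rewrite (pushed_interval pushforwardP ell1 (interval_chainP T T0)).
  have GE : ell (G T) =
      time_average (fun t => \sum_(i <- s) g i t * ell (C i)) T.
    rewrite time_average_sum => [|i t]; last first.
      by apply: cvgM; [exact: cg|exact: cvg_cst].
    rewrite /G linear_sum; apply: eq_bigr => i _.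
    by rewrite linearZ /= time_averageZ.
  have cgL : continuous (fun t => \sum_(i <- s) g i t * ell (C i)).
    move=> t; apply: cvg_sum_seq => i.
    by apply: cvgM; [exact: cg|exact: cvg_cst].
  rewrite linearB GE JE -time_averageB//; apply: le_trans (ler_norm _) _.
  apply: time_average_le => // [t|t].
    by apply: cvgB; [exact: cgL|exact: cL].
  (* The weights add up to 1, so [L t] and e / 2 are spread over the same weights and the comparison
     is made term by term. *)
  have sum1 (c : R) : c = \sum_(i <- s) f i (phi p t) * c.
    by rewrite -mulr_suml f1 mul1r.
  rewrite [L t]sum1 [leRHS]sum1 -sumrB.
  apply: le_trans (ler_norm_sum _ _ _) _.
  apply: ler_sum => i _; rewrite /g -mulrBr normrM (ger0_norm (f0 _ _)).
  apply: le_trans _ (fe i (phi p t)); rewrite ler_wpM2l//.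
  by rewrite /L -linearB distrC; exact: ell1.
exists (\sum_(i <- s) b i *: C i); near=> T.
rewrite -(subrKA (G T)) (splitr e); apply: le_lt_trans (ler_normD _ _) _.
apply: ltr_leD; last by apply: GJ; near: T; exact: nbhs_pinfty_gt.
by near: T; apply: cvgr_dist_lt.
Unshelve. all: by end_near. Qed.
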